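(* Let $d\in\mathbb{N}$ and let $\Omega\subset\mathbb{R}^d$ be a connected, bounded $C^1$ domain. Let $M,\delta,\kappa,r_0>0$ and $\sigma\geq 1$ be constants. Then for any measurable set $E\subset\Omega$ with positive measure there is a constant $C>0$, depending only on $M,\delta,\kappa,r_0,\sigma,|\Omega|/|E|$, and $\Omega$, such that the following holds. If $f\in C^\infty(\Omega)$ satisfies $$\Vert \partial^\alpha f\Vert_{L^\infty(\Omega)}\leq \frac{M\,(|\alpha|!)^{\sigma}}{\delta^{|\alpha|}}\Vert f\Vert_{L^\infty(\Omega)}\qquad\text{for all }\alpha\in\mathbb{N}_0^d$$ and $$\Vert f\Vert_{L^\infty(B_{2r}(x)\cap\Omega)}\leq \kappa\,\Vert f\Vert_{L^\infty(B_r(x)\cap\Omega)}\qquad\text{for all }r\in(0,r_0]\text{ and all }x\in\Omega,$$ then $$\Vert f\Vert_{L^\infty(\Omega)}\leq C\,\Vert f\Vert_{L^\infty(E)}.$$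
   Context: $|\cdot|$ denotes Lebesgue measure of sets, and $|\alpha|=\alpha_1+\cdots+\alpha_d$ for a multi-index $\alpha\in\mathbb{N}_0^d$. $B_r(x)$ is the open Euclidean ball of radius $r$ centered at $x$. *)

(* Defs.v *)
From HB Require Import structures.
From mathcomp Require Import all_boot all_order all_algebra.
From mathcomp Require Import all_classical all_reals all_analysis.
From mathcomp.real_closed Require Import complex.

Set Implicit Arguments.
Unset Strict Implicit.
Unset Printing Implicit Defensive.

Import Order.TTheory GRing.Theory Num.Theory.
Import numFieldNormedType.Exports.

Local Open Scope classical_set_scope.
Local Open Scope ring_scope.

(* Lebesgue measure on R^d.  The library only has it for d = 1, so it is built
   here as usual: outer measure by countable covers with boxes, then
   Caratheodory's theorem (which the library provides). *)

Section LebesgueOuterMeasure.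
Context {R : realType} {d : nat}.

Definition box (q : 'rV[R]_d * 'rV[R]_d) : set 'rV[R]_d :=
  [set x | forall i, q.1 0 i < x 0 i <= q.2 0 i].

Definition box_volume (q : 'rV[R]_d * 'rV[R]_d) : R :=
  \prod_(i < d) Num.max 0 (q.2 0 i - q.1 0 i).

Local Open Scope ereal_scope.

Definition lebesgue_outer (A : set 'rV[R]_d) : \bar R :=
  ereal_inf [set \sum_(k <oo) (box_volume (Q k))%:E |
             Q in [set Q : nat -> 'rV[R]_d * 'rV[R]_d |
                   A `<=` \bigcup_k box (Q k)]].

Lemma box_volume_ge0 q : (0 <= box_volume q)%R.
Proof. by apply: prodr_ge0 => i _; rewrite le_max lexx. Qed.

Lemma lebesgue_outer_ge0 A : 0 <= lebesgue_outer A.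
Proof.
apply: le_ereal_inf_tmp => _ [Q _ <-]; apply: nneseries_ge0 => k _ _.
by rewrite lee_fin box_volume_ge0.
Qed.

Lemma le_lebesgue_outer : {homo lebesgue_outer : A B / A `<=` B >-> A <= B}.
Proof.
move=> A B AB; apply: ereal_inf_le_tmp => _ [Q BQ <-].
by exists Q => //; apply: subset_trans BQ.
Qed.

Lemma lebesgue_outer_sigma_subadditive : sigma_subadditive lebesgue_outer.
Proof.
move=> A; have [[i ioo]|] := pselect (exists i, lebesgue_outer (A i) = +oo).
  rewrite (eseries_pinfty _ _ ioo) ?leey// => n _.
  by rewrite -ltNye (lt_le_trans _ (lebesgue_outer_ge0 _)).
rewrite -forallNE => Aoo.
suff add2e (e : {posnum R}) : lebesgue_outer (\bigcup_n A n) <=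
    \sum_(i <oo) lebesgue_outer (A i) + e%:num%:E.
  by apply/lee_addgt0Pr => _/posnumP[].
rewrite (le_trans _ (epsilon_trick _ _ _))//; last first.
  by move=> n; exact: lebesgue_outer_ge0.
pose P n (Q : nat -> 'rV[R]_d * 'rV[R]_d) := A n `<=` \bigcup_k box (Q k) /\
  \sum_(k <oo) (box_volume (Q k))%:E <=
  lebesgue_outer (A n) + (e%:num / (2 ^ n.+1)%:R)%:E.
have [G PG] : {G : nat -> nat -> 'rV[R]_d * 'rV[R]_d & forall n, P n (G n)}.
  apply: (@choice _ _ P) => n; rewrite /P.
  have en1 : (0 < e%:num / (2 ^ n.+1)%:R :> R)%R by [].
  have fin : lebesgue_outer (A n) \is a fin_num.
    by rewrite ge0_fin_numE ?lebesgue_outer_ge0// ltey; apply/eqP/Aoo.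
  have [_ [Q AQ <-] /ltW Qle] := lb_ereal_inf_adherent en1 fin.
  by exists Q.
pose v i := (box_volume (uncurry G i))%:E.
have v0 i : 0 <= v i by rewrite lee_fin box_volume_ge0.
apply: (@le_trans _ _ (\esum_(i in setT) v i)).
  apply: ereal_inf_lbound => /=.
  have /card_esym/ppcard_eqP[f] := card_nat2.
  exists (uncurry G \o f).
    move=> t [i _ /(PG i).1[j _ Gijt]]; exists (f^-1%FUN (i, j)) => //=.
    by rewrite invK ?inE.
  rewrite -(esum_pred_image v f xpredT) ?[fun=> _]set_true//.
  by rewrite image_eq.
rewrite (_ : esum _ _ = \sum_(i <oo) \sum_(j <oo) (box_volume (G i j))%:E).
  by apply: lee_nneseries => n *; [apply: nneseries_ge0 => k _ _; rewrite lee_fin box_volume_ge0|exact: (PG n).2].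
pose J : nat -> set (nat * nat) := fun i => [set (i, j) | j in setT].
rewrite (_ : setT = \bigcup_k J k); last first.
  by rewrite predeqE => -[a b]; split => // _; exists a => //; exists b.
rewrite esum_bigcupT//=; last first.
  apply/trivIsetP => i j _ _ ij.
  rewrite predeqE => -[n m] /=; split => //= -[] [_] _ [<-{n} _].
  by move=> [m' _] [] /esym/eqP; rewrite (negbTE ij).
rewrite -(image_id [set: nat]) -fun_true esum_pred_image//; last first.
  by move=> n _; exact: esum_ge0.
apply: eq_eseriesr => /= j _.
rewrite -(esum_pred_image v (pair j) predT)//=; last first.
  by move=> ? ? _ _; exact: (@can_inj _ _ _ snd).
by congr esum; rewrite predeqE => -[a b]; split; move=> [i _ <-]; exists i.
Qed.

End LebesgueOuterMeasure.

(* Positive dimension is needed: for d = 0 the only box is the whole space. *)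
Lemma lebesgue_outer0 (R : realType) (n : nat) :
  @lebesgue_outer R n.+1 set0 = 0%E.
Proof.
apply/eqP; rewrite eq_le lebesgue_outer_ge0 andbT.
apply: ereal_inf_lbound; exists (fun=> (0, 0)) => //=.
apply: eseries0 => k _ _ /=.
by rewrite /box_volume (bigD1 ord0)//= subrr maxxx mul0r.
Qed.

HB.instance Definition _ (R : realType) (n : nat) :=
  isOuterMeasure.Build R 'rV[R]_n.+1 (@lebesgue_outer R n.+1)
    (lebesgue_outer0 R n) lebesgue_outer_ge0 le_lebesgue_outer
    lebesgue_outer_sigma_subadditive.

Definition lebesgue_outer_measure (R : realType) (n : nat) :
    {outer_measure set 'rV[R]_n.+1 -> \bar R} :=
  @lebesgue_outer R n.+1.

(* R^(n+1) with the sigma-algebra of Lebesgue (not only Borel) measurable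
   sets. *)
Notation lebesgue_space R n := (caratheodory_type (lebesgue_outer_measure R n)).

Definition lebesgue (R : realType) (n : nat) :
    {measure set (lebesgue_space R n) -> \bar R} :=
  [the measure _ _ of lebesgue_outer_measure R n : set (lebesgue_space R n) -> _].

(* The norm that the library puts on row vectors is the sup norm (which gives
   the same topology and bounded sets), so Euclidean balls are defined here. *)
Definition eball (R : realType) (d : nat) (x : 'rV[R]_d) (r : R) :
    set 'rV[R]_d :=
  [set y | Num.sqrt (\sum_(i < d) (y 0 i - x 0 i) ^+ 2) < r].

Definition C1 (R : realType) (d : nat) (g : 'rV[R]_d -> R) : Prop :=
  (forall x, differentiable g x) /\ (forall v, continuous (fun x => 'd g x v)).

(* Near each boundary point, in some orthonormal coordinates, the set is the
   region strictly above the graph of a C^1 function. *)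
Definition C1_domain (R : realType) (n : nat) (Omega : set 'rV[R]_n.+1) : Prop :=
  open Omega /\
  forall x, closure Omega x -> closure (~` Omega) x ->
    exists (r : R) (U : 'M[R]_n.+1) (g : 'rV[R]_n -> R),
      [/\ 0 < r, U *m U^T = 1%:M, C1 g &
        forall y, eball x r y ->
          (Omega y <-> g (col' ord_max (y *m U)) < (y *m U) 0 ord_max)].

Section Derivatives.
Context {R : realType} {d : nat}.
Implicit Types (g : 'rV[R]_d -> R) (f : 'rV[R]_d -> R[i]).

Definition partial (i : 'I_d) g : 'rV[R]_d -> R := 'D_(delta_mx 0 i) g.

Definition partials (s : seq 'I_d) g : 'rV[R]_d -> R := foldr partial g s.

(* Only the values of g on the open set Omega matter. *)
Definition smooth_on (Omega : set 'rV[R]_d) g : Prop :=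
  forall s : seq 'I_d, forall x, Omega x ->
    {for x, continuous (partials s g)} /\
    forall i : 'I_d, derivable (partials s g) x (delta_mx 0 i).

Definition mi_abs (alpha : {ffun 'I_d -> nat}) : nat := (\sum_(i < d) alpha i)%N.

Definition mpartial (alpha : {ffun 'I_d -> nat}) g : 'rV[R]_d -> R :=
  partials (flatten [seq nseq (alpha i) i | i <- enum 'I_d]) g.

(* Complex-valued functions are differentiated componentwise. *)
Definition csmooth_on (Omega : set 'rV[R]_d) f : Prop :=
  smooth_on Omega (fun x => complex.Re (f x)) /\
  smooth_on Omega (fun x => complex.Im (f x)).

Definition cmpartial (alpha : {ffun 'I_d -> nat}) f : 'rV[R]_d -> R[i] :=
  fun x => Complex (mpartial alpha (fun y => complex.Re (f y)) x)
                   (mpartial alpha (fun y => complex.Im (f y)) x).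

End Derivatives.

(* L^oo norm over A: f is cut off to 0 outside A. *)
Definition Linfty (R : realType) (n : nat) (A : set 'rV[R]_n.+1)
    (f : 'rV[R]_n.+1 -> R[i]) : \bar R :=
  Lnorm (lebesgue R n) +oo%E
    ((fun x : lebesgue_space R n => (Normc.normc (f x))%:E) \_ A).

(* Main.v *)
Require Import Defs.
From mathcomp Require Import all_boot all_order all_algebra.
From mathcomp Require Import all_classical all_reals all_analysis.
From mathcomp.real_closed Require Import complex.
From mathcomp Require Import ess_sup_inf ring lra zify.

(** The idea is to compare two rates at a small scale.  The doubling condition
    forces [f] to be fairly large on every small ball: going down from radius
    [r0] to radius [r0 / 2 ^ l] loses at most a factor [kappa ^ l], up to a
    constant, which is only a fixed power of the radius.  On the other hand,
    on a small cube that contains a fixed proportion of [E], a smooth function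
    is bounded by its size on [E] plus an error of order [rho ^ p], where
    [rho] is the side of the cube and [p] the number of derivatives used.
    Once [p] exceeds the power coming from doubling, the error is negligible at
    a small enough scale, and what remains is a bound by the size of [f] on
    [E].

    The upper estimate is a Remez inequality for smooth functions
    ([cube_remez]).  In dimension one it comes from the mean value theorem
    ([separated_bound]): a function that is small at [2 ^ p] separated points
    and has a small [p]-th derivative is small.  In higher dimension one
    applies this to one coordinate after another, choosing good slices by a
    Fubini argument; to avoid slicing measurable sets, the argument is carried
    out on the cells of a fine grid, which need only be counted
    ([slice_bound]).

    The lower estimate is [controls_Omega]: on the connected set [Omega] a chain
    of overlapping balls transports a bound from one ball of radius [r0] to
    all others.

    It remains to find a good cube inside [Omega].  The part of [Omega] close to
    its boundary has small measure ([inner_exhaustion]), so most of [E] is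
    covered by grid cubes inside [Omega], and [E] fills one of these to a
    proportion that depends only on [Omega] and the measure of [E].
    Everything is assembled in [sup_le_on_positive_measure], for pointwise
    bounds; [Linfty_le], [Linfty_ae] and [Linfty_nbhs] translate these into
    essential suprema. *)

Import Order.TTheory GRing.Theory Num.Theory.
Import numFieldNormedType.Exports.

Local Open Scope classical_set_scope.
Local Open Scope ring_scope.

Set Implicit Arguments.
Unset Strict Implicit.
Unset Printing Implicit Defensive.

(** * Functions of one variable *)

Lemma MVT_itvoc (R : realType) (f df : R -> R) (a b u v : R) :
  (forall t, a < t <= b -> is_derive t 1 f (df t)) ->
  a < u <= b -> a < v <= b -> u < v ->
  exists2 w, u < w < v & f v - f u = df w * (v - u).
Proof.
move=> fdf /andP[au ub] /andP[av vb] uv.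
have fder t : u <= t <= v -> is_derive t 1 f (df t).
  by move=> /andP[ut tv]; apply: fdf; rewrite (lt_le_trans au ut) (le_trans tv vb).
have [||w] := @MVT R f df u v uv.
- by move=> t; rewrite in_itv/= => /andP[/ltW ut /ltW tv]; apply: fder; rewrite ut.
- apply: derivable_within_continuous => t; rewrite in_itv/= => utv.
  exact: (@ex_derive _ _ _ _ _ _ _ (fder t utv)).
by rewrite in_itv/=; exists w.
Qed.

Lemma lipschitz_itvoc (R : realType) (f df : R -> R) (a b B : R) :
  (forall t, a < t <= b -> is_derive t 1 f (df t)) ->
  (forall t, a < t <= b -> `|df t| <= B) ->
  forall u v, a < u <= b -> a < v <= b -> `|f u - f v| <= B * `|u - v|.
Proof.
move=> fdf dfB.
have lt_case u v : a < u <= b -> a < v <= b -> u < v ->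
    `|f u - f v| <= B * `|u - v|.
  move=> uI vI uv; have [w /andP[uw wv] fvu] := MVT_itvoc fdf uI vI uv.
  rewrite distrC fvu (distrC u) normrM ler_wpM2r// dfB//.
  by move: uI vI => /andP[au ub] /andP[av vb]; rewrite (lt_trans au uw) (le_trans (ltW wv) vb).
move=> u v uI vI; have [uv|vu|->] := ltgtP u v; first exact: lt_case.
  by rewrite distrC (distrC u); exact: lt_case.
by rewrite !subrr normr0 mulr0.
Qed.

Definition separated (R : realType) (eta : R) (N : nat) (s : nat -> R) : Prop :=
  forall i, (i.+1 < N)%N -> s i + eta <= s i.+1.

(** A smooth function that is small at many well-spaced points of an interval
    is small on the whole interval, up to the size of its [p]-th derivative.
    The mean value theorem on every other gap between the points turns
    smallness of [phi 0] at [2 ^ p] points into smallness of [phi 1] at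
    [2 ^ p.-1] points, and skipping gaps keeps these new points separated; so
    induction bounds [phi 1] everywhere, hence the variation of [phi 0].
    Gaps are measured relatively to the length of the interval, which makes
    [C] scale invariant. *)
Lemma separated_bound (R : realType) (p : nat) (eta : R) : 0 < eta ->
  exists2 C : R, 0 < C & forall (phi : nat -> R -> R) (a b eps A : R) (s : nat -> R),
    a < b -> 0 <= eps -> 0 <= A ->
    (forall k t, (k < p)%N -> a < t <= b -> is_derive t 1 (phi k) (phi k.+1 t)) ->
    (forall t, a < t <= b -> `|phi p t| <= A) ->
    separated (eta * (b - a)) (2 ^ p) s ->
    (forall i, (i < 2 ^ p)%N -> a < s i <= b /\ `|phi 0%N (s i)| <= eps) ->
    forall t, a < t <= b -> `|phi 0%N t| <= C * (eps + A * (b - a) ^+ p).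
Proof.
move=> eta0; elim: p => [|p [C C0 IH]].
  exists 1 => // phi a b eps A s ab e0 A0 _ phiA _ _ t tI.
  by rewrite mul1r expr0 mulr1 (le_trans (phiA t tI))// lerDr.
exists (1 + (2 / eta + 1) * C).
  by rewrite addr_gt0// mulr_gt0// addr_gt0// divr_gt0.
move=> phi a b eps A s ab e0 A0 dphi phiA sep sP t tI.
have ba0 : 0 < b - a by rewrite subr_gt0.
have step i : (i < 2 ^ p)%N -> exists w, s i.*2 < w < s i.*2.+1 /\
    `|phi 1%N w| <= 2 * eps / (eta * (b - a)).
  move=> ip; have i2 : (i.*2.+1 < 2 ^ p.+1)%N by rewrite expnS mul2n; lia.
  have [uI ue] := sP i.*2 (ltnW i2); have [vI ve] := sP i.*2.+1 i2.
  have gap := sep _ i2.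
  have gap0 : 0 < eta * (b - a) by rewrite mulr_gt0.
  have uv : s i.*2 < s i.*2.+1 by rewrite (lt_le_trans _ gap)// ltrDl.
  have [w wuv E] := MVT_itvoc (dphi 0%N ^~ isT) uI vI uv.
  exists w; split => //.
  rewrite ler_pdivlMr//.
  have vu0 : 0 < s i.*2.+1 - s i.*2 by rewrite subr_gt0.
  have : `|phi 1%N w| * (s i.*2.+1 - s i.*2) <= 2 * eps.
    rewrite -[X in _ * X]gtr0_norm// -normrM -E (le_trans (ler_normB _ _))//; lra.
  by apply: le_trans; rewrite ler_wpM2l// lerBrDl.
(* w i lies in the gap between s (2 i) and s (2 i + 1) *)
have [w wP] : {w : nat -> R & forall i, (i < 2 ^ p)%N ->
    s i.*2 < w i < s i.*2.+1 /\ `|phi 1%N (w i)| <= 2 * eps / (eta * (b - a))}.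
  apply: (@choice _ _ (fun i x => (i < 2 ^ p)%N -> s i.*2 < x < s i.*2.+1 /\
    `|phi 1%N x| <= 2 * eps / (eta * (b - a)))) => i.
  have [ip|] := boolP (i < 2 ^ p)%N; last by exists 0.
  by have [x xP] := step i ip; exists x.
have phi1 : forall u, a < u <= b ->
    `|phi 1%N u| <= C * (2 * eps / (eta * (b - a)) + A * (b - a) ^+ p).
  apply: (IH (fun k => phi k.+1) a b _ A w) => //.
  - by rewrite divr_ge0 ?mulr_ge0// ltW.
  - by move=> k u kp; exact: dphi.
  - move=> i i1; have [/andP[_ wi] _] := wP i (ltnW i1).
    have [/andP[wi1 _] _] := wP i.+1 i1.
    have i2 : (i.*2.+2 < 2 ^ p.+1)%N by rewrite expnS mul2n; lia.
    have := sep i.*2.+1 i2; rewrite doubleS in wi1; lra.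
  - move=> i ip; have [/andP[w1 w2] ?] := wP i ip; split => //.
    have i2 : (i.*2.+1 < 2 ^ p.+1)%N by rewrite expnS mul2n; lia.
    have [/andP[u1 _] _] := sP i.*2 (ltnW i2).
    have [/andP[_ v2] _] := sP i.*2.+1 i2.
    by rewrite (lt_trans u1 w1) (le_trans (ltW w2) v2).
have [s0I s0e] := sP 0%N (expn_gt0 2 p.+1).
have := lipschitz_itvoc (dphi 0%N ^~ isT) phi1 tI s0I.
set B := C * _ => lip.
have B0 : 0 <= B.
  by rewrite mulr_ge0 ?(ltW C0)// addr_ge0 ?mulr_ge0 ?exprn_ge0 ?invr_ge0 ?mulr_ge0// ltW.
have ts : `|t - s 0%N| <= b - a.
  by move: tI s0I => /andP[? ?] /andP[? ?]; rewrite ler_norml; apply/andP; split; lra.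
have lip' : `|phi 0%N t| <= eps + B * (b - a).
  rewrite -[phi 0%N t](subrK (phi 0%N (s 0%N))) (le_trans (ler_normD _ _))// addrC.
  by rewrite lerD// (le_trans lip)// ler_wpM2l.
rewrite (le_trans lip')//.
have -> : B * (b - a) = C * (2 / eta * eps + A * (b - a) ^+ p.+1).
  by rewrite /B exprS; field; rewrite !gt_eqF.
set X := A * _.
have X0 : 0 <= X by rewrite mulr_ge0 ?exprn_ge0// ltW.
have CX := mulr_ge0 (ltW C0) X0; have Ce := mulr_ge0 (ltW C0) e0.
have h0 : 0 <= 2 / eta by rewrite divr_ge0// ltW.
have hCX := mulr_ge0 h0 CX.
have -> : (1 + (2 / eta + 1) * C) * (eps + X) =
    eps + C * (2 / eta * eps + X) + (X + C * eps + 2 / eta * (C * X)) by ring.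
by rewrite lerDl !addr_ge0.
Qed.

(** * Dense sets of indices *)

Lemma sorted_nth_gap (s : seq nat) (i q : nat) :
  sorted ltn s -> (i + q < size s)%N -> (nth 0%N s i + q <= nth 0%N s (i + q))%N.
Proof.
move=> s_sorted; elim: q => [|q IH] iq; first by rewrite !addn0.
rewrite addnS in iq; rewrite !addnS.
apply: (leq_ltn_trans (IH (ltnW iq))).
by apply: (sorted_ltn_nth ltn_trans 0%N s_sorted); rewrite ?inE ?(ltnW iq).
Qed.

(** If the average of [u] over [0, ..., K - 1] is at least a fixed proportion
    [theta] of its maximal possible value [B], then [u] is at least half that
    proportion of [B] at a proportion [theta / 2] of the indices (Markov's
    inequality for the complement), and taking every [q]-th of these indices
    leaves [P] of them that are far apart. *)
Lemma dense_pick (R : realType) (P K : nat) (theta B : R) (u : nat -> R) :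
  (0 < P)%N -> 0 < theta -> 0 < B -> P%:R <= theta / 2 * K%:R ->
  (forall j, (j < K)%N -> u j <= B) ->
  theta * (K%:R * B) <= \sum_(j < K) u j ->
  exists tau : nat -> nat,
    (forall i, (i < P)%N -> (tau i < K)%N /\ theta / 2 * B <= u (tau i)) /\
    (forall i, (i.+1 < P)%N ->
       (tau i)%:R + theta / (4 * P%:R) * K%:R <= (tau i.+1)%:R :> R).
Proof.
move=> P0 theta0 B0 PK uB sumu.
have P0R : 0 < P%:R :> R by rewrite ltr0n.
pose good j := theta / 2 * B <= u j.
pose T := [seq j <- iota 0 K | good j].
have sizeT : theta / 2 * K%:R <= (size T)%:R.
  have : \sum_(j < K) u j <= (size T)%:R * B + K%:R * (theta / 2 * B).
    rewrite -(big_mkord xpredT u) (bigID good)/= lerD//.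
      rewrite big_mkcond/= (le_trans (y := \sum_(0 <= j < K) (good j)%:R * B))//.
        rewrite !big_nat; apply: ler_sum => j /andP[_ jK].
        by case: (good j); rewrite ?mul1r ?mul0r// uB.
      rewrite -mulr_suml ler_wpM2r ?(ltW B0)//.
      rewrite /T size_filter -sum1_count natr_sum /index_iota subn0.
      rewrite big_mkcond/= [leRHS]big_mkcond/= le_eqVlt; apply/orP; left.
      by apply/eqP/eq_bigr => j _; case: (good j).
    rewrite big_mkcond/= (le_trans (y := \sum_(0 <= j < K) (theta / 2 * B)))//.
      apply: ler_sum => j _; rewrite -ltNge; case: ltP => [/ltW//|_].
      by rewrite mulr_ge0 ?divr_ge0 ?(ltW B0) ?(ltW theta0).
    by rewrite sumr_const_nat subn0 mulr_natl.
  move=> /(le_trans sumu) ?; rewrite -(ler_pM2r B0); lra.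
(* consecutive picks are q positions apart in the increasing list T *)
pose q := (size T %/ P)%N.
have PT : (P <= size T)%N by rewrite -(ler_nat R) (le_trans PK).
have q1 : (0 < q)%N by rewrite divn_gt0.
have sizeq : (size T <= 2 * P * q)%N.
  have := divn_eq (size T) P; have := ltn_pmod (size T) P0; rewrite -/q; nia.
have qT i : (i < P)%N -> (i * q < size T)%N.
  move=> iP; rewrite (leq_trans (n := P * q))// ?ltn_pmul2r//.
  by rewrite mulnC leq_divM.
have T_sorted : sorted ltn T.
  by apply: sorted_filter; [exact: ltn_trans|exact: iota_ltn_sorted].
exists (fun i => nth 0%N T (i * q)); split => i iP.
  have := mem_nth 0%N (qT i iP).
  by rewrite mem_filter mem_iota add0n => /andP[? ?].
have := @sorted_nth_gap T (i * q) q T_sorted; rewrite addnC -mulSn => /(_ (qT _ iP)).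
rewrite -(ler_nat R) natrD; apply: le_trans; rewrite lerD2l.
have -> : theta / (4 * P%:R) * K%:R = theta / 2 * K%:R / (2 * P%:R).
  by field; rewrite gt_eqF.
rewrite ler_pdivrMr ?mulr_gt0// (le_trans sizeT)// mulrC -!natrM.
by rewrite ler_nat.
Qed.

(** * Grids in a cube *)

Section Slabs.
Context {R : realType} {d : nat}.
Implicit Types (a x : 'rV[R]_d) (s : nat -> nat).

Definition cube a (r : R) : set 'rV[R]_d :=
  [set x | forall i, a 0 i < x 0 i <= a 0 i + r].

(** Multi-indices are functions on [nat], read only at the indices below
    [d]; this makes changing one of their entries painless. *)
Definition upd s (k j : nat) : nat -> nat := fun i => if i == k then j else s i.

(** The cube of side [h * K] at [a] is cut into [K ^ d] cells of side [h].  A slab is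
    the union of the cells whose index agrees with [s] from coordinate [k] on:
    it is one cell for [k = 0] and the whole cube for [k = d], so that
    induction on [k] frees the coordinates one at a time. *)
Definition slab a (h : R) (K k : nat) s : set 'rV[R]_d :=
  [set x | forall i : 'I_d, if (i < k)%N then a 0 i < x 0 i <= a 0 i + h * K%:R
    else a 0 i + h * (s i)%:R < x 0 i <= a 0 i + h * (s i).+1%:R].

(** Iterated sum of [w] over the cells of a slab.  Since the sum over
    coordinate [k] is outermost, Fubini's theorem for counting cells holds by
    definition. *)
Fixpoint grid_sum (K : nat) (w : (nat -> nat) -> R) (k : nat) s : R :=
  if k is k'.+1 then \sum_(j < K) grid_sum K w k' (upd s k' j) else w s.

Lemma itv_subdivision (b h t : R) (K : nat) : b < t <= b + h * K%:R ->
  exists2 j : nat, (j < K)%N & b + h * j%:R < t <= b + h * j.+1%:R.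
Proof.
elim: K => [|K IH] /andP[bt tb].
  by move: (lt_le_trans bt tb); rewrite mulr0 addr0 ltxx.
have [tK|Kt] := leP t (b + h * K%:R).
  by have [|j jK jP] := IH _; [rewrite bt|exists j => //; exact: ltnW].
by exists K => //; rewrite Kt.
Qed.

Lemma slab_cube a h K s : slab a h K d s = cube a (h * K%:R).
Proof.
by apply/seteqP; split => x /= xS i; have := xS i; rewrite ltn_ord.
Qed.

Lemma slabS a h K k s (kd : (k < d)%N) :
  slab a h K k.+1 s `<=` \bigcup_(j in [set j | (j < K)%N]) slab a h K k (upd s k j).
Proof.
move=> x xS; have := xS (Ordinal kd); rewrite /= ltnSn.
move=> /itv_subdivision[j jK jP]; exists j => // i.
have [ik|ki|ik] := ltngtP i k.
- by have := xS i; rewrite ltnS (ltnW ik).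
- by have := xS i; rewrite ltnS leqNgt ki /upd gtn_eqF.
- by rewrite /upd ik eqxx; have -> : i = Ordinal kd by exact: val_inj.
Qed.

Lemma grid_sum_bound K w k s (B : R) : (forall s, w s <= B) ->
  grid_sum K w k s <= B * K%:R ^+ k.
Proof.
move=> wB; elim: k s => [|k IH] s /=; first by rewrite expr0 mulr1.
rewrite (le_trans (ler_sum _ (fun j _ => IH _)))//.
by rewrite sumr_const card_ord exprSr mulrA mulr_natr.
Qed.

Definition setc x (i : 'I_d) (t : R) : 'rV[R]_d :=
  \row_j (if j == i then t else x 0 j).

Lemma setcK x i : setc x i (x 0 i) = x.
Proof. by apply/rowP => j; rewrite mxE; case: eqP => // ->. Qed.

Lemma setc_setc x i t u : setc (setc x i t) i u = setc x i u.
Proof. by apply/rowP => j; rewrite !mxE; case: eqP. Qed.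

Lemma setc_eq x i t : setc x i t 0 i = t.
Proof. by rewrite mxE eqxx. Qed.

Lemma cube_setc a r x i t : cube a r x -> a 0 i < t <= a 0 i + r ->
  cube a r (setc x i t).
Proof. by move=> xQ tI j; rewrite mxE; case: eqP => [->|]. Qed.

(** Only iterated derivatives along a single coordinate axis enter the
    argument; they are ordinary derivatives of the restrictions of [g] to
    lines parallel to the axes. *)
Definition line_derivable (p : nat) (g : 'rV[R]_d -> R) (Q : set 'rV[R]_d) :=
  forall i x k, (k < p)%N -> Q x ->
    is_derive (x 0 i) 1 (fun t => partials (nseq k i) g (setc x i t))
      (partials (nseq k.+1 i) g x).

Lemma line_derivable_setc p g a r i x k t : line_derivable p g (cube a r) ->
  (k < p)%N -> cube a r x -> a 0 i < t <= a 0 i + r ->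
  is_derive t 1 (fun t => partials (nseq k i) g (setc x i t))
    (partials (nseq k.+1 i) g (setc x i t)).
Proof.
move=> dg kp xQ tI; have := dg i _ k kp (cube_setc xQ tI).
by rewrite setc_eq; under eq_fun do rewrite setc_setc.
Qed.

(** A discrete Remez inequality, proved like Fubini's theorem.  If a proportion
    [theta] of the cells of a slab is marked, then a proportion [theta / 2] of
    its slices orthogonal to coordinate [k] has a proportion [theta / 2] of
    marked cells.  By induction [g] is small on these slices, and
    [separated_bound] in direction [k] propagates the smallness from well-spaced
    slices to the whole slab.  It matters that [C] does not depend on the
    fineness [K] of the grid. *)
Lemma slice_bound (p k : nat) : (k <= d)%N -> forall theta : R, 0 < theta ->
  exists C : R, 0 < C /\ exists K0 : nat, forall K, (K0 <= K)%N -> (0 < K)%N ->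
  forall g a h eps A (S : (nat -> nat) -> bool), 0 < h -> 0 <= eps -> 0 <= A ->
  line_derivable p g (cube a (h * K%:R)) ->
  (forall i x, cube a (h * K%:R) x -> `|partials (nseq p i) g x| <= A) ->
  (forall s, S s -> forall x, cube a (h * K%:R) x -> slab a h K 0 s x ->
     `|g x| <= eps) ->
  forall s, theta * K%:R ^+ k <= grid_sum K (fun s => (S s)%:R) k s ->
  forall x, cube a (h * K%:R) x -> slab a h K k s x ->
    `|g x| <= C * (eps + A * (h * K%:R) ^+ p).
Proof.
elim: k => [|k IH] kd theta theta0.
  exists 1; split=> //; exists 0%N => K _ K0 g a h eps A S h0 e0 A0 dg gA gS s.
  rewrite /= expr0 mulr1 mul1r; case: (boolP (S s)) => Ss; last by rewrite leNgt theta0.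
  move=> _ x xQ xs; rewrite (le_trans (gS s Ss x xQ xs))// lerDl mulr_ge0//.
  by rewrite exprn_ge0// mulr_ge0// ltW.
have theta20 : 0 < theta / 2 by rewrite divr_gt0.
have [C1 [C10 [K1 IHK]]] := IH (ltnW kd) _ theta20.
(* separated_bound asks for 2 ^ p slices *)
have P0 : (0 < 2 ^ p)%N by rewrite expn_gt0.
set P := (2 ^ p)%N in P0.
have eta0 : 0 < theta / (4 * P%:R) by rewrite divr_gt0// mulr_gt0// ltr0n.
have [C2 C20 sepB] := separated_bound p eta0.
have C0 : 0 < C2 * (C1 + 1) by rewrite mulr_gt0// addr_gt0.
exists (C2 * (C1 + 1)); split => //.
exists (maxn K1 (Num.bound (P%:R / (theta / 2)))) => K.
rewrite geq_max => /andP[K1K KP] K0 g a h eps A S h0 e0 A0 dg gA gS s.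
have PK : P%:R <= theta / 2 * K%:R.
  have /archi_boundP/ltW Pb : 0 <= P%:R / (theta / 2) by rewrite divr_ge0// ltW.
  rewrite mulrC -ler_pdivrMr//; apply: le_trans Pb _.
  by rewrite ler_nat.
move=> sumS x xQ xs.
have K0R : 0 < K%:R :> R by rewrite ltr0n.
have hK0 : 0 < h * K%:R by rewrite mulr_gt0.
pose u j := grid_sum K (fun s => (S s)%:R) k (upd s k j).
have [] := @dense_pick R P K theta (K%:R ^+ k) u P0 theta0 (exprn_gt0 _ K0R) PK.
- move=> j _; rewrite /u -[leRHS]mul1r.
  by apply: grid_sum_bound => s'; rewrite lern1 leq_b1.
- by rewrite -exprS.
move=> tau [tauP tau_gap].
pose i0 := Ordinal kd.
set X := eps + A * _.
have X0 : 0 <= A * (h * K%:R) ^+ p by rewrite mulr_ge0// exprn_ge0// ltW.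
(* x moves along the line through x in direction k *)
pose phi m t := partials (nseq m i0) g (setc x i0 t).
have bE : a 0 i0 + h * K%:R - a 0 i0 = h * K%:R by rewrite addrC addKr.
have : `|phi 0%N (x 0 i0)| <= C2 * (C1 * X + A * (a 0 i0 + h * K%:R - a 0 i0) ^+ p).
  apply: (sepB phi (a 0 i0) (a 0 i0 + h * K%:R) (C1 * X) A
    (fun i => a 0 i0 + h * (tau i).+1%:R)) => //.
  - by rewrite ltrDl.
  - by rewrite mulr_ge0 ?(ltW C10)// addr_ge0.
  - by move=> m t mp tI; exact: (line_derivable_setc dg mp xQ tI).
  - by move=> t tI; apply: gA; exact: cube_setc.
  - move=> i iP; rewrite bE -addrA lerD2l [_ * (h * _)]mulrCA -mulrDr ler_pM2l//.
    by rewrite -(natr1 (tau i)) -(natr1 (tau i.+1)); move: (tau_gap i iP); lra.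
  - move=> i iP; have [tK ut] := tauP i iP.
    have tI : a 0 i0 < a 0 i0 + h * (tau i).+1%:R <= a 0 i0 + h * K%:R.
      by rewrite ltrDl mulr_gt0//= lerD2l ler_pM2l// ler_nat.
    split => //; apply: (IHK K K1K K0 g a h eps A S h0 e0 A0 dg gA gS _ ut).
      exact: cube_setc.
    move=> j; rewrite mxE; have := xs j; rewrite /upd.
    have [->|ji] := eqVneq j i0.
      rewrite /= ltnn eqxx => _; rewrite lexx andbT ltrD2l ltr_pM2l// ltr_nat.
      exact: ltnSn.
    have jk : (val j == k) = false by apply/negbTE; apply: contra ji => /eqP jk; apply/eqP/val_inj.
    by rewrite jk ltnS leq_eqVlt jk.
rewrite /phi setcK bE => /le_trans; apply.
rewrite -mulrA ler_pM2l// mulrDl mul1r lerD2l /X lerDr//.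
Qed.

End Slabs.

(** * A Remez inequality on cubes *)

(** Moving from [x] to [y] one coordinate at a time stays inside the cube; the
    hypothesis on the coordinates from [k] on is what the induction runs on. *)
Lemma cube_oscillation (R : realType) (d : nat) (g : 'rV[R]_d -> R)
    (a : 'rV[R]_d) (r B h : R) (k : nat) :
  line_derivable 1 g (cube a r) -> 0 <= B ->
  (forall i x, cube a r x -> `|partials [:: i] g x| <= B) ->
  (k <= d)%N -> forall x y, cube a r x -> cube a r y ->
  (forall i : 'I_d, `|x 0 i - y 0 i| <= h) ->
  (forall i : 'I_d, (k <= i)%N -> x 0 i = y 0 i) ->
  `|g x - g y| <= k%:R * (B * h).
Proof.
move=> dg B0 gB; elim: k => [|k IH] kd x y xQ yQ xyh xy.
  have -> : x = y by apply/rowP => i; exact: xy.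
  by rewrite subrr normr0 mul0r.
pose i0 := Ordinal kd; pose z := setc x i0 (y 0 i0).
have zQ : cube a r z by apply: cube_setc.
have gz : `|g z - g y| <= k%:R * (B * h).
  apply: IH => //; first exact: ltnW.
    move=> i; rewrite mxE; case: eqP => [->|_]; last exact: xyh.
    by rewrite subrr normr0 (le_trans _ (xyh i)).
  move=> i ki; rewrite mxE; case: eqP => [->//|/eqP ii0]; apply: xy.
  rewrite ltn_neqAle ki andbT eq_sym; apply: contra ii0 => /eqP ik.
  exact/eqP/val_inj.
have gxz : `|g x - g z| <= B * h.
  have -> : g x = g (setc x i0 (x 0 i0)) by rewrite setcK.
  have := lipschitz_itvoc (f := fun t => g (setc x i0 t))
    (fun t tI => line_derivable_setc dg (ltn0Sn 0) xQ tI)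
    (fun t tI => gB i0 _ (cube_setc xQ tI)) (xQ i0) (yQ i0).
  by move/le_trans; apply; rewrite ler_wpM2l.
rewrite -[g x](subrK (g z)) -addrA (le_trans (ler_normD _ _))//.
by rewrite -natr1 mulrDl mul1r [leRHS]addrC lerD.
Qed.

Section OuterMeasure.
Context {R : realType} {n : nat}.
Local Notation d := n.+1.
Implicit Types (A : set 'rV[R]_d).

Lemma lebesgue_outer_box (q : 'rV[R]_d * 'rV[R]_d) :
  (lebesgue_outer (box q) <= (box_volume q)%:E)%E.
Proof.
apply: ereal_inf_lbound; exists (fun k => if k == 0%N then q else (0, 0)).
  by move=> x xq; exists 0%N.
rewrite (nneseries_split 0 1)//=; last by move=> *; rewrite lee_fin box_volume_ge0.
rewrite add0n big_nat1/= eseries0 ?adde0// => -[|k]//= _ _.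
by rewrite /box_volume (bigD1 ord0)//= subrr maxxx mul0r.
Qed.

Lemma lebesgue_outer_slab0 (a : 'rV[R]_d) (h : R) (K : nat) (s : nat -> nat) : 0 <= h ->
  (lebesgue_outer (slab a h K 0 s) <= (h ^+ d)%:E)%E.
Proof.
move=> h0.
pose q := (\row_i (a 0 i + h * (s i)%:R), \row_i (a 0 i + h * (s i).+1%:R)) : 'rV[R]_d * 'rV[R]_d.
have -> : slab a h K 0 s = box q.
  by apply/seteqP; split => x xs i; have := xs i; rewrite /= !mxE.
apply: (le_trans (lebesgue_outer_box q)); rewrite lee_fin /box_volume.
rewrite (eq_bigr (fun=> h)) ?prodr_const ?card_ord// => i _.
by rewrite /q /= !mxE opprD addrACA subrr add0r -mulrBr -natrB// subSnn mulr1 max_r.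
Qed.

(** Subadditivity of the outer measure, applied one coordinate at a time. *)
Lemma lebesgue_outer_slab A (a : 'rV[R]_d) (h : R) (K : nat) w :
  (forall s, (lebesgue_outer (A `&` slab a h K 0 s) <= (w s)%:E)%E) ->
  forall k s, (k <= d)%N ->
  (lebesgue_outer (A `&` slab a h K k s) <= (grid_sum K w k s)%:E)%E.
Proof.
move=> Aw; elim=> [|k IH] s kd /=; first exact: Aw.
pose F j := A `&` slab a h K k (upd s k j).
have AF : A `&` slab a h K k.+1 s `<=` \big[setU/set0]_(j < K) F j.
  by move=> x [xA /(slabS kd)[j jK xj]]; rewrite -bigcup_mkord; exists j.
have := outer_measure_subadditive (lebesgue_outer_measure R n) F K.
rewrite /lebesgue_outer_measure/= => AK.
rewrite (le_trans (le_lebesgue_outer AF))// (le_trans AK)// -sumEFin.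
by apply: lee_sum => j _; apply: IH; exact: ltnW.
Qed.

Lemma grid_sumZ K (c : R) w k s :
  grid_sum K (fun s => c * w s) k s = c * grid_sum K w k s.
Proof.
elim: k s => [//|k IH] s /=; rewrite mulr_sumr.
by apply: eq_bigr => j _; exact: IH.
Qed.

(** Remez inequality for smooth functions: on a cube, [g] is controlled by its
    size on any subset of proportion at least [theta], up to the natural error
    term of order [r ^ p].  Mark the cells of a grid that meet [F].  They cover
    [F], so their proportion is at least [theta], and on a marked cell [g]
    exceeds [eps] by at most its oscillation.  The bound [B] on the gradient
    makes the oscillation vanish as the grid gets finer, while the constant of
    [slice_bound] stays the same; this is why [B] is absent from the
    conclusion.  Only upper bounds for the measure enter, so the argument
    applies to arbitrary sets [F]. *)
Lemma cube_remez (p : nat) (theta : R) : 0 < theta ->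
  exists2 C : R, 0 < C &
  forall (g : 'rV[R]_d -> R) (a : 'rV[R]_d) (r eps A B : R) (F : set 'rV[R]_d),
  0 < r -> 0 <= eps -> 0 <= A -> 0 <= B ->
  line_derivable p g (cube a r) -> line_derivable 1 g (cube a r) ->
  (forall i x, cube a r x -> `|partials (nseq p i) g x| <= A) ->
  (forall i x, cube a r x -> `|partials [:: i] g x| <= B) ->
  (forall x, F x -> `|g x| <= eps) ->
  ((theta * r ^+ d)%:E <= lebesgue_outer (F `&` cube a r))%E ->
  forall x, cube a r x -> `|g x| <= C * (eps + A * r ^+ p).
Proof.
move=> theta0; have [C [C0 [K0 slice]]] := slice_bound p (leqnn d) theta0.
exists C => // g a r eps A B F r0 e0 A0 B0 dg dg1 gA gB gF muF x xQ.
apply/ler_addgt0Pr => e e_gt0.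
(* a grid so fine that the oscillation on its cells is at most e / C *)
pose N := Num.bound (d%:R * (B * r) / (e / C)).
pose K := maxn (maxn K0 1) N.
have K_gt0 : (0 < K)%N by rewrite /K !leq_max ltnSn orbT.
have KR : 0 < K%:R :> R by rewrite ltr0n.
have hKr : r / K%:R * K%:R = r by rewrite divfK// gt_eqF.
have h0 : 0 < r / K%:R by rewrite divr_gt0.
have Ke : d%:R * (B * (r / K%:R)) <= e / C.
  have eC : 0 < e / C by rewrite divr_gt0.
  have /archi_boundP/ltW : 0 <= d%:R * (B * r) / (e / C).
    by rewrite divr_ge0 ?(ltW eC)// mulr_ge0// mulr_ge0// ltW.
  move=> NP; have -> : d%:R * (B * (r / K%:R)) = d%:R * (B * r) / K%:R by rewrite !mulrA.
  rewrite ler_pdivrMr// [leRHS]mulrC -ler_pdivrMr// (le_trans NP)// ler_nat.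
  exact: leq_maxr.
pose S s := `[< exists y, [/\ F y, cube a r y & slab a (r / K%:R) K 0 s y] >].
have := slice K; rewrite {1}/K leq_max leq_max leqnn => /(_ isT K_gt0).
move=> /(_ g a (r / K%:R) (eps + e / C) A S h0); rewrite hKr.
have eC0 : 0 <= eps + e / C by rewrite addr_ge0// divr_ge0// ltW.
move=> /(_ eC0 A0 dg gA) H.
have {}H := H _ (fun=> 0%N) _ x xQ.
have -> : C * (eps + A * r ^+ p) + e = C * (eps + e / C + A * r ^+ p).
  by field; rewrite gt_eqF.
apply: H; last by rewrite slab_cube hKr.
- move=> s /asboolP[y [yF yQ ys]] z zQ zs.
  rewrite -[g z](subrK (g y)) (le_trans (ler_normD _ _))// addrC lerD ?gF//.
  apply: le_trans Ke; apply: (cube_oscillation dg1) => //.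
    move=> i; have /andP[? ?] := ys i; have /andP[? ?] := zs i.
    have : a 0 i + r / K%:R * (s i).+1%:R = a 0 i + r / K%:R * (s i)%:R + r / K%:R.
      by rewrite -natr1 mulrDr mulr1 addrA.
    move=> E; rewrite ler_norml; apply/andP; split; lra.
  by move=> i; rewrite leqNgt ltn_ord.
- have : forall s, (lebesgue_outer ((F `&` cube a r) `&` slab a (r / K%:R) K 0 s)
      <= ((r / K%:R) ^+ d * (S s)%:R)%:E)%E.
    move=> s; case: (boolP (S s)) => [Ss|/asboolPn Ss].
      rewrite mulr1 (le_trans _ (lebesgue_outer_slab0 a K s (ltW h0)))//.
      by apply: le_lebesgue_outer; exact: subIsetr.
    rewrite mulr0 [X in lebesgue_outer X](_ : _ = set0) ?lebesgue_outer0//.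
    by rewrite -subset0 => y [[yF yQ] ys]; apply: Ss; exists y.
  move=> /lebesgue_outer_slab/(_ d (fun=> 0%N) (leqnn _)).
  rewrite slab_cube hKr -setIA setIid => /(le_trans muF).
  rewrite lee_fin grid_sumZ -{1}hKr exprMn [leLHS]mulrCA ler_pM2l//.
  exact: exprn_gt0.
Qed.

End OuterMeasure.

(** * Lebesgue measure of open sets *)

Section Measure.
Context {R : realType} {n : nat}.
Local Notation d := n.+1.
Local Notation mu := (lebesgue_outer_measure R n).
Implicit Types (A U : set 'rV[R]_d) (x : 'rV[R]_d).

Lemma ball_rowP x (e : R) y :
  ball x e y <-> 0 < e /\ forall i, `|x 0 i - y 0 i| < e.
Proof.
split => [[e0 xy]|[e0 xy]]; split => // i; first exact: xy.
by move=> j; rewrite !ord1; exact: xy.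
Qed.

Lemma bounded_coord A : bounded_set A ->
  exists2 B : R, 0 < B & forall x, A x -> forall i, `|x 0 i| < B.
Proof.
move=> [M [_ bA]]; exists (Num.max M 0 + 1); first by rewrite ltr_wpDl// le_max lexx orbT.
move=> x Ax i; have Mx : M < Num.max M 0 + 2^-1.
  by rewrite (@le_lt_trans _ _ (Num.max M 0)) ?le_max ?lexx// ltrDl.
have := bA _ Mx x Ax => /= xM.
apply: (@le_lt_trans _ _ `|x|); last by rewrite (le_lt_trans xM)// ltrD2l invf_lt1// ltr1n.
by rewrite [leRHS]/Num.norm/= mx_normrE; apply/bigmax_geP; right => /=; exists (ord0, i).
Qed.

(** A half-space cuts every box into two boxes whose volumes add up. *)
Lemma caratheodory_halfspace (i : 'I_d) (c : R) :
  mu.-caratheodory [set x | x 0 i <= c].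
Proof.
apply: le_caratheodory_measurable => X.
apply: le_ereal_inf_tmp => _ [Q XQ <-].
pose low (q : 'rV[R]_d * 'rV[R]_d) : 'rV[R]_d * 'rV[R]_d :=
  (q.1, \row_j (if j == i then Num.min (q.2 0 j) c else q.2 0 j)).
pose high (q : 'rV[R]_d * 'rV[R]_d) : 'rV[R]_d * 'rV[R]_d :=
  (\row_j (if j == i then Num.max (q.1 0 j) c else q.1 0 j), q.2).
have volE q : box_volume (low q) + box_volume (high q) = box_volume q.
  have vol1 q' : box_volume q' = Num.max 0 (q'.2 0 i - q'.1 0 i) *
      \prod_(j < d | j != i) Num.max 0 (q'.2 0 j - q'.1 0 j).
    by rewrite /box_volume (bigD1 i).
  rewrite !vol1 /= !mxE eqxx.
  rewrite [X in _ * X + _](eq_bigr (fun j => Num.max 0 (q.2 0 j - q.1 0 j))); last first.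
    by move=> j /negbTE ji; rewrite mxE ji.
  rewrite [X in _ + _ * X](eq_bigr (fun j => Num.max 0 (q.2 0 j - q.1 0 j))); last first.
    by move=> j /negbTE ji; rewrite mxE ji.
  rewrite -mulrDl; congr (_ * _).
  rewrite /Num.min /Num.max.
  by repeat case: ifPn; rewrite -?leNgt => *; lra.
have -> : (\sum_(k <oo) (box_volume (Q k))%:E = \sum_(k <oo) (box_volume (low (Q k)))%:E +
    \sum_(k <oo) (box_volume (high (Q k)))%:E)%E.
  rewrite -nneseriesD; try by move=> *; rewrite lee_fin box_volume_ge0.
  by apply: eq_eseriesr => k _; rewrite -EFinD volE.
apply: leeD; apply: ereal_inf_lbound.
- exists (low \o Q) => // x [/XQ[k _ xQ] /= xc]; exists k => // j /=.
  rewrite mxE; have /andP[-> xj] := xQ j; case: eqP => //= ->.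
  by rewrite le_min xc andbT; have /andP[] := xQ i.
- exists (high \o Q) => // x [/XQ[k _ xQ] /= /negP]; rewrite -ltNge => xc; exists k => // j /=.
  rewrite mxE; have /andP[xj ->] := xQ j; case: eqP => [->|]; rewrite andbT//.
  by rewrite gt_max xc andbT; have /andP[] := xQ i.
Qed.

Lemma measurable_box (q : 'rV[R]_d * 'rV[R]_d) :
  measurable (box q : set (lebesgue_space R n)).
Proof.
have -> : box q = \bigcap_(i in [set: 'I_d])
    ([set x | x 0 i <= q.2 0 i] `\` [set x | x 0 i <= q.1 0 i]).
  apply/seteqP; split => [x xq i _ /=|x xq i].
    by have /andP[? ?] := xq i; split => //; apply/negP; rewrite -ltNge.
  by have [/= ? /negP] := xq i I; rewrite -ltNge => ?; apply/andP.
apply: fin_bigcap_measurable; first exact: finite_finset.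
by move=> i _; apply: measurableD; exact: caratheodory_halfspace.
Qed.

(** An open set is the union of the countably many boxes with rational corners
    that it contains; [pickle] turns this union into one indexed by [nat]. *)
Lemma measurable_open_row U : open U -> measurable (U : set (lebesgue_space R n)).
Proof.
move=> oU.
pose T := {ffun 'I_d -> rat * rat}.
pose B (q : T) : set 'rV[R]_d :=
  box (\row_i ratr (q i).1, \row_i ratr (q i).2).
pose F k := if unpickle k is Some q then if `[< B q `<=` U >] then B q else set0 else set0.
have -> : U = \bigcup_k F k.
  apply/seteqP; split => [x Ux|x [k _]]; last first.
    by rewrite /F; case: (unpickle k) => // q; case: asboolP => // BU; exact: BU.
  have /nbhs_ballP[e /= e0 eU] := open_nbhs_nbhs (conj oU Ux).
  have /choice[q qP] : forall i, exists q : rat * rat,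
      x 0 i - e < ratr q.1 < x 0 i /\ x 0 i < ratr q.2 < x 0 i + e.
    move=> i.
    have [|l lP] := @rat_in_itvoo R (x 0 i - e) (x 0 i); first by rewrite ltrBlDr ltrDl.
    have [|u uP] := @rat_in_itvoo R (x 0 i) (x 0 i + e); first by rewrite ltrDl.
    by exists (l, u); move: lP uP; rewrite !in_itv.
  exists (pickle [ffun i => q i]) => //; rewrite /F pickleK.
  case: asboolP => [_|[]]; last first.
    move=> y yq; apply: eU; apply/ball_rowP; split=> // i.
    have := yq i; rewrite !mxE ffunE => /andP[? ?].
    have [/andP[? ?] /andP[? ?]] := qP i.
    by rewrite ltr_norml; apply/andP; split; lra.
  move=> i; rewrite !mxE ffunE; have [/andP[? ?] /andP[? ?]] := qP i.
  by apply/andP; split => //; exact: ltW.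
apply: bigcup_measurable => k _; rewrite /F.
case: (unpickle k) => [q|]; last exact: measurable0.
by case: asboolP => _; [exact: measurable_box|exact: measurable0].
Qed.

Lemma lebesgue_outer_translate A (v : 'rV[R]_d) :
  (lebesgue_outer [set x | A (x + v)%R] <= lebesgue_outer A)%E.
Proof.
apply: le_ereal_inf_tmp => _ [Q AQ <-].
apply: ereal_inf_lbound; exists (fun k => ((Q k).1 - v, (Q k).2 - v)).
  move=> x /= /AQ[k _ xQ]; exists k => // i /=; have := xQ i.
  by rewrite !mxE ltrBlDr lerBrDr.
apply: eq_eseriesr => k _; congr EFin; apply: eq_bigr => i _ /=; congr Num.max.
by rewrite !mxE; ring.
Qed.

Definition corner (c : R) : 'rV[R]_d := \row_i - c.

Lemma sub_cube_corner A (B : R) : (forall x, A x -> forall i, `|x 0 i| < B) ->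
  A `<=` cube (corner B) (2 * B).
Proof.
move=> AB x Ax i; have := AB x Ax i; rewrite mxE ltr_norml => /andP[? ?].
by apply/andP; split=> //; lra.
Qed.

Lemma lebesgue_outer_bounded A : bounded_set A -> (lebesgue_outer A < +oo)%E.
Proof.
move=> /bounded_coord[B B0 AB].
have B20 : 0 <= 2 * B by rewrite mulr_ge0// ltW.
apply: (le_lt_trans _ (ltry ((2 * B) ^+ d))).
apply: le_trans (lebesgue_outer_slab0 (corner B) 1 (fun=> 0%N) B20).
apply: le_lebesgue_outer => x /(sub_cube_corner AB) xQ i.
by have := xQ i; rewrite /= mulr0 addr0 mulr1.
Qed.

(** That nonempty open sets have positive measure would usually follow from the
    measure of a box being its volume, a compactness argument.  It is cheaper
    to deduce it from the existence of one bounded set [A] of positive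
    measure: if some open set were null, then by translation invariance every
    cell of a fine grid would be null, and [A] is covered by finitely many
    cells. *)
Lemma lebesgue_outer_nbhs A U x : bounded_set A -> (0 < lebesgue_outer A)%E ->
  nbhs x U -> (0 < lebesgue_outer U)%E.
Proof.
move=> /bounded_coord[B B0 AB] A0 /nbhs_ballP[e /= e0 eU].
rewrite lt_neqAle lebesgue_outer_ge0 andbT; apply/negP => /eqP/esym U0.
pose K := (Num.bound (2 * B / e)).+1.
have K0 : 0 < K%:R :> R by rewrite ltr0n.
pose h := 2 * B / K%:R.
have B20 : 0 < 2 * B by rewrite mulr_gt0.
have h0 : 0 < h by rewrite divr_gt0.
have he : h < e.
  rewrite /h ltr_pdivrMr// [ltRHS]mulrC -ltr_pdivrMr//.
  have /archi_boundP/lt_le_trans : 0 <= 2 * B / e by rewrite divr_ge0// ltW.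
  by apply; rewrite ler_nat.
have sub s : (lebesgue_outer (A `&` slab (corner B) h K 0 s) <= 0%:E)%E.
  pose c : 'rV[R]_d := \row_i (x 0 i - (corner B 0 i + h * (s i).+1%:R)).
  have : (lebesgue_outer U <= 0%:E)%E by rewrite U0.
  apply: le_trans; apply: le_trans (lebesgue_outer_translate U c).
  apply: le_lebesgue_outer => y [_ ys] /=; apply: eU; apply/ball_rowP; split => // i.
  have := ys i; rewrite /= -natr1 mulrDr mulr1 => /andP[y1 y2].
  rewrite !mxE ltr_norml -natr1 mulrDr mulr1; rewrite mxE in y1 y2.
  by apply/andP; split; lra.
have := lebesgue_outer_slab sub (fun=> 0%N) (leqnn d).
rewrite slab_cube /h divfK ?gt_eqF// setIidl; last exact: sub_cube_corner.
apply/negP; rewrite -ltNge (le_lt_trans _ A0)// lee_fin.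
by rewrite (le_trans (grid_sum_bound (B := 0) _ _ _ _))// mul0r.
Qed.

(** The points of [U] at distance less than [c / 2 ^ l] from the complement form
    open sets that decrease to the empty set. *)
Lemma inner_exhaustion U (c v : R) : open U -> bounded_set U -> 0 < c -> 0 < v ->
  exists N, forall l, (N <= l)%N ->
    (lebesgue_outer (U `\` [set x | ball x (c / 2 ^+ l) `<=` U]) <= v%:E)%E.
Proof.
move=> oU bU c0 v0.
have cl0 l : 0 < c / 2 ^+ l by rewrite divr_gt0// exprn_gt0.
pose F l := U `\` [set x | ball x (c / 2 ^+ l) `<=` U].
have FE l : F l = U `&` \bigcup_(y in ~` U) ball y (c / 2 ^+ l).
  apply/seteqP; split => x [Ux].
    move=> /existsNP[y /not_implyP[xy Uy]]; split => //; exists y => //.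
    exact: ball_sym.
  by move=> [y Uy /ball_sym xy]; split => // /(_ _ xy).
have mF l : measurable (F l : set (lebesgue_space R n)).
  rewrite FE; apply: measurable_open_row; apply: openI => //.
  by apply: bigcup_open => y _; exact: ball_open.
have F0 : \bigcap_l F l = set0.
  rewrite -subset0 => x Fx; have [Ux _] := Fx 0%N I.
  have /nbhs_ballP[e /= e0 eU] := open_nbhs_nbhs (conj oU Ux).
  have [l cle] : exists l, c / 2 ^+ l <= e.
    exists (Num.bound (c / e)); have /archi_boundP/ltW ce : 0 <= c / e by rewrite divr_ge0// ltW.
    rewrite ler_pdivrMr ?exprn_gt0// [leRHS]mulrC -ler_pdivrMr// (le_trans ce)//.
    by rewrite -natrX ler_nat ltnW// ltn_expl.
  have [_] := Fx l I; apply => y xy; apply: eU; exact: le_ball xy.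
have ni : nonincreasing_seq F.
  apply/nonincreasing_seqP => l; rewrite subsetEset => x [Ux xU]; split => // xl; apply: xU.
  move=> y xy; apply: xl; apply: le_ball xy.
  by rewrite ler_pM2l// lef_pV2 ?posrE ?exprn_gt0// ler_weXn2l// ler1n.
have fin0 : (lebesgue R n (F 0%N) < +oo)%E.
  by rewrite (le_lt_trans _ (lebesgue_outer_bounded bU))//; apply: le_lebesgue_outer; exact: subDsetl.
have := nonincreasing_cvg_mu fin0 mF _ ni.
rewrite F0 measure0 => /(_ measurable0)/fine_cvgP[fin_near /cvgr_le/(_ v v0) le_near].
have [N _ NP] := filterI fin_near le_near.
exists N => l /NP[/= fl]; rewrite -lee_fin fineK//.
Qed.

End Measure.

(** * Chains of balls *)

Section EuclideanBalls.
Context {R : realType} {d : nat}.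
Implicit Types (x y z : 'rV[R]_d) (r : R).

Lemma eballP x r y : 0 < r ->
  eball x r y <-> \sum_(i < d) (y 0 i - x 0 i) ^+ 2 < r ^+ 2.
Proof.
move=> r0; rewrite /eball/= -[X in _ < X](gtr0_norm r0) -sqrtr_sqr ltr_sqrt//.
exact: exprn_gt0.
Qed.

Lemma eballxx x r : 0 < r -> eball x r x.
Proof.
by move=> r0; apply/eballP => //; rewrite big1 ?exprn_gt0// => i _; rewrite subrr expr0n.
Qed.

Lemma eball_sym x r y : 0 < r -> eball x r y -> eball y r x.
Proof.
move=> r0 /(eballP _ _ r0) xy; apply/(eballP _ _ r0).
by under eq_bigr do rewrite -sqrrN opprB.
Qed.

(** For equal radii the triangle inequality follows from
    [(u + v)^2 <= 2 u^2 + 2 v^2]. *)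
Lemma eball_double x r y z : 0 < r -> eball x r y -> eball y r z -> eball x (2 * r) z.
Proof.
move=> r0 /(eballP _ _ r0) xy /(eballP _ _ r0) yz; apply/eballP; first by rewrite mulr_gt0.
apply: (@le_lt_trans _ _ (\sum_(i < d) (2 * (z 0 i - y 0 i) ^+ 2 + 2 * (y 0 i - x 0 i) ^+ 2))).
  apply: ler_sum => i _; rewrite -subr_ge0.
  have -> : 2 * (z 0 i - y 0 i) ^+ 2 + 2 * (y 0 i - x 0 i) ^+ 2 - (z 0 i - x 0 i) ^+ 2 =
    (z 0 i - y 0 i - (y 0 i - x 0 i)) ^+ 2 by ring.
  exact: sqr_ge0.
rewrite big_split/= -!mulr_sumr; lra.
Qed.

Lemma eball_coord x r y i : 0 < r -> eball x r y -> `|y 0 i - x 0 i| < r.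
Proof.
move=> r0 /(eballP _ _ r0) xy; rewrite -(ltr_pXn2r (n := 2))// ?nnegrE ?(ltW r0)//.
rewrite real_normK ?num_real// (le_lt_trans _ xy)// (bigD1 i)//= lerDl.
by apply: sumr_ge0 => j _; exact: sqr_ge0.
Qed.

Lemma eball_close x r (h : R) y : 0 < r -> d%:R * h < r ->
  (forall i, `|y 0 i - x 0 i| <= h) -> eball x r y.
Proof.
move=> r0 dhr xy; apply/eballP => //.
have [d0|d0] := posnP d.
  by rewrite big1 ?exprn_gt0// => i; have := ltn_ord i; rewrite {2}d0.
have h0 : 0 <= h by apply: le_trans (xy (Ordinal d0)).
have dh0 : 0 <= d%:R * h by rewrite mulr_ge0.
apply: (@le_lt_trans _ _ ((d%:R * h) ^+ 2)); last by rewrite ltr_pXn2r// ?nnegrE// ltW.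
apply: (@le_trans _ _ (\sum_(i < d) h ^+ 2)).
  apply: ler_sum => i _; rewrite -[leLHS]real_normK ?num_real//.
  by rewrite ler_pXn2r// nnegrE.
rewrite sumr_const card_ord -[leLHS]mulr_natl exprMn ler_wpM2r ?sqr_ge0//.
by rewrite -natrX ler_nat expnS expn1 leq_pmulr.
Qed.

End EuclideanBalls.

Lemma eball_open (R : realType) (n : nat) (x : 'rV[R]_n.+1) (r : R) : open (eball x r).
Proof.
pose q (y : 'rV[R]_n.+1) := \sum_(i < n.+1) (y 0 i - x 0 i) ^+ 2.
have -> : eball x r = (Num.sqrt \o q) @^-1` [set t | t < r] by [].
apply: open_comp; last exact: open_lt.
move=> y _; apply: continuous_comp; last exact: sqrt_continuous.
move: y; apply: (@continuous_big R 'I_n.+1 +%R 0 xpredT add_continuous _ _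
  (fun i (y : 'rV[R]_n.+1) => (y 0 i - x 0 i) ^+ 2)) => i _ y.
have yi : (fun y : 'rV[R]_n.+1 => y 0 i - x 0 i) @ y --> y 0 i - x 0 i.
  apply: (cvgB (@coord_continuous R 1 n.+1 0 i y) (cvg_cst (x 0 i))).
exact: (cvgM yi yi).
Qed.

(** A compactness argument in disguise: a property of sets that passes to subsets
    and to finite unions and that holds locally, i.e. on all cells of a grid,
    holds on the whole cube. *)
Lemma slab_ind (R : realType) (d : nat) (a : 'rV[R]_d) (h : R) (K : nat)
    (W : set 'rV[R]_d -> Prop) :
  (forall A B, A `<=` B -> W B -> W A) -> W set0 ->
  (forall A B, W A -> W B -> W (A `|` B)) ->
  (forall s, W (slab a h K 0 s)) ->
  forall k s, (k <= d)%N -> W (slab a h K k s).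
Proof.
move=> Wsub W0 WU Wslab; elim=> [|k IH] s kd; first exact: Wslab.
pose F j := slab a h K k (upd s k j).
apply: (Wsub _ (\big[setU/set0]_(j < K) F j)).
  by move=> x /(slabS kd)[j jK xj]; rewrite -bigcup_mkord; exists j.
by elim/big_ind : _ => // j _; apply: IH; exact: ltnW.
Qed.

Section Doubling.
Context {R : realType} {n : nat}.
Variables (Omega : set 'rV[R]_n.+1) (kappa r0 : R).
Hypotheses (Omega_conn : connected Omega) (Omega_bnd : bounded_set Omega)
  (kappa_gt0 : 0 < kappa) (r0_gt0 : 0 < r0).
Local Notation d := n.+1.
Implicit Types (x y z : 'rV[R]_d) (A B : set 'rV[R]_d) (h : 'rV[R]_d -> R).

Definition bounded_on h A (c : R) := forall y, A y -> Omega y -> h y <= c.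

(** The doubling condition on the supremum of [h] over balls, phrased with upper
    bounds [c] so that suprema need not be formed. *)
Definition doubling h := forall r x c, 0 < r -> r <= r0 -> Omega x -> 0 <= c ->
  bounded_on h (eball x r) c -> bounded_on h (eball x (2 * r)) (kappa * c).

Lemma doubling_iter h x k c : doubling h -> Omega x -> 0 <= c ->
  bounded_on h (eball x (r0 / 2 ^+ k)) c -> bounded_on h (eball x r0) (kappa ^+ k * c).
Proof.
move=> dh Ox; elim: k c => [|k IH] c c0; first by rewrite !expr0 divr1 mul1r.
have r0k : 0 < r0 / 2 ^+ k.+1 by rewrite divr_gt0// exprn_gt0.
have r0k1 : r0 / 2 ^+ k.+1 <= r0.
  by rewrite ler_pdivrMr ?exprn_gt0// ler_peMr ?(ltW r0_gt0)// exprn_ege1// ler1n.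
move=> /(dh _ _ _ r0k r0k1 Ox c0).
have -> : 2 * (r0 / 2 ^+ k.+1) = r0 / 2 ^+ k by rewrite exprS; field; rewrite expf_neq0.
by move=> /IH; rewrite exprSr mulrA; apply; rewrite mulr_ge0// ltW.
Qed.

(** The constant [C] must serve all doubling functions at once. *)
Definition controls A B := exists2 C, 0 < C &
  forall h c, doubling h -> 0 <= c -> bounded_on h A c -> bounded_on h B (C * c).

Lemma controls_trans A B D : controls A B -> controls B D -> controls A D.
Proof.
move=> [C1 C10 AB] [C2 C20 BD]; exists (C2 * C1); first exact: mulr_gt0.
move=> h c dh c0 /(AB _ _ dh c0)/(BD _ _ dh).
by rewrite mulrA; apply; rewrite mulr_ge0// ltW.
Qed.

Lemma controls_near x y : Omega x -> eball x r0 y ->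
  controls (eball x r0) (eball y r0).
Proof.
move=> Ox xy; exists kappa => // h c dh c0 hx z yz Oz.
apply: (dh _ _ _ r0_gt0 (lexx _) Ox c0 hx) => //.
exact: eball_double xy yz.
Qed.

(** The centres whose ball is controlled by the ball at [x] form an open subset
    of [Omega], and so do the other points of [Omega], because nearby balls
    control each other. *)
Lemma controls_connected x y : Omega x -> Omega y ->
  controls (eball x r0) (eball y r0).
Proof.
move=> Ox Oy.
pose S := [set z | Omega z /\ controls (eball x r0) (eball z r0)].
suff SE : S = Omega by have : S y; [rewrite SE|case].
apply: Omega_conn.
- by exists x; split => //; apply: controls_near => //; exact: eballxx.
- exists (\bigcup_(z in S) eball z r0).
    by apply: bigcup_open => z _; exact: eball_open.
  apply/seteqP; split => [z Sz|z [Oz [w [Ow xw] wz]]].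
    by split; [exact: Sz.1|exists z => //; exact: eballxx].
  by split => //; apply: (controls_trans xw); exact: controls_near.
(* S is also relatively closed *)
- exists (~` \bigcup_(z in Omega `\` S) eball z r0).
    by apply: open_closedC; apply: bigcup_open => z _; exact: eball_open.
  apply/seteqP; split => [z Sz|z [Oz zS]].
    split; first exact: Sz.1.
    move=> [w [Ow Sw] wz]; apply: Sw; split => //; apply: (controls_trans Sz.2).
    by apply: controls_near; [exact: Sz.1|exact: eball_sym].
  apply: contrapT => Sz; apply: zS; exists z; first by split.
  exact: eballxx.
Qed.

(** A bound on any one ball of radius [r0] gives a bound on [Omega].  By
    [controls_connected] any two such balls control each other, and the
    constant can be chosen uniformly since [Omega] is covered by finitely many
    cells of diameter less than [r0].  The property [W A] records both
    directions: balls centred in [A] control a fixed ball, which controls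
    [A]. *)
Lemma controls_Omega : exists2 C, 0 < C & forall h c x, doubling h -> 0 <= c ->
  Omega x -> bounded_on h (eball x r0) c -> bounded_on h setT (C * c).
Proof.
have [->|/set0P[x0 Ox0]] := eqVneq Omega set0; first by exists 1 => // h c x _ _ [].
pose W A := (exists2 C, 0 < C & forall h c x, doubling h -> 0 <= c -> Omega x -> A x ->
    bounded_on h (eball x r0) c -> bounded_on h (eball x0 r0) (C * c)) /\
  controls (eball x0 r0) A.
have [B B0 OB] := bounded_coord Omega_bnd.
pose K := (Num.bound (d%:R * (2 * B) / r0)).+1.
have K0 : 0 < K%:R :> R by rewrite ltr0n.
pose t := 2 * B / K%:R.
have tr0 : d%:R * t < r0.
  rewrite /t mulrA ltr_pdivrMr// [ltRHS]mulrC -ltr_pdivrMr//.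
  have /archi_boundP/lt_le_trans : 0 <= d%:R * (2 * B) / r0.
    by rewrite divr_ge0 ?(ltW r0_gt0)// mulr_ge0// mulr_ge0// ltW.
  by apply; rewrite ler_nat.
(* t is the side of the cells; dimension times t bounds their diameter *)
have : W (slab (corner B) t K d (fun=> 0%N)).
  apply: (slab_ind (W := W)) => //.
  - move=> A D AD [[C C0 HC] [C' C'0 HC']]; split; [exists C => //|exists C' => //].
      by move=> h c x dh c0 Ox /AD; exact: HC.
    by move=> h c dh c0 hx y /AD; exact: (HC' h c dh c0 hx).
  - by split; [exists 1 => // h c x _ _ _ []|exists 1 => // h c _ _ _ y []].
  - move=> A D [[C1 C10 H1] [C1' C1'0 H1']] [[C2 C20 H2] [C2' C2'0 H2']]; split.
      exists (C1 + C2); first exact: addr_gt0.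
      move=> h c x dh c0 Ox [Ax|Dx] hx y x0y Oy.
        by rewrite (le_trans (H1 h c x dh c0 Ox Ax hx y x0y Oy))// ler_wpM2r// lerDl ltW.
      by rewrite (le_trans (H2 h c x dh c0 Ox Dx hx y x0y Oy))// ler_wpM2r// lerDr ltW.
    exists (C1' + C2'); first exact: addr_gt0.
    move=> h c dh c0 hx y [Ay|Dy] Oy.
      by rewrite (le_trans (H1' h c dh c0 hx y Ay Oy))// ler_wpM2r// lerDl ltW.
    by rewrite (le_trans (H2' h c dh c0 hx y Dy Oy))// ler_wpM2r// lerDr ltW.
  - move=> s.
    have slab_close x y : slab (corner B) t K 0 s x -> slab (corner B) t K 0 s y -> eball x r0 y.
      move=> xs ys; apply: (eball_close r0_gt0 tr0) => i.
      have := ys i; have := xs i; rewrite /= -natr1 mulrDr mulr1 => /andP[? ?] /andP[? ?].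
      by rewrite ler_norml; apply/andP; split; lra.
    have [[x1 [Ox1 x1s]]|noO] := pselect (exists x, Omega x /\ slab (corner B) t K 0 s x); last first.
      by split; exists 1 => //; [move=> h c x _ _ Ox xs|move=> h c _ _ _ x xs Ox];
        exfalso; apply: noO; exists x.
    split.
      have [C C0 HC] := controls_connected Ox1 Ox0.
      exists (C * kappa); first exact: mulr_gt0.
      move=> h c x dh c0 Ox xs hx; rewrite -mulrA; apply: HC => //.
        by rewrite mulr_ge0// ltW.
      move=> y x1y Oy; apply: (dh _ _ _ r0_gt0 (lexx _) Ox c0 hx) => //.
      exact: eball_double (slab_close _ _ xs x1s) x1y.
    have [C C0 HC] := controls_connected Ox0 Ox1.
    exists C => // h c dh c0 hx y ys Oy.
    by apply: (HC h c dh c0 hx) => //; exact: slab_close.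
rewrite slab_cube /t divfK ?gt_eqF// => -[[C1 C10 H1] [C2 C20 H2]].
exists (C2 * C1); first exact: mulr_gt0.
move=> h c x dh c0 Ox hx y _ Oy; rewrite -mulrA; apply: H2 => //.
- by rewrite mulr_ge0// ltW.
- by apply: (H1 h c x) => //; exact: (sub_cube_corner OB).
- exact: (sub_cube_corner OB).
Qed.

End Doubling.

(** * The pointwise estimate *)

Section Complex.
Context {R : realType}.
Implicit Types (u v : R).

Lemma normcE (z : R[i]) : Normc.normc z = Num.sqrt (complex.Re z ^+ 2 + complex.Im z ^+ 2).
Proof. by case: z. Qed.

Lemma normc_Re (z : R[i]) : `|complex.Re z| <= Normc.normc z.
Proof.
by rewrite normcE -sqrtr_sqr ler_sqrt ?lerDl ?addr_ge0 ?sqr_ge0.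
Qed.

Lemma normc_Im (z : R[i]) : `|complex.Im z| <= Normc.normc z.
Proof.
by rewrite normcE -sqrtr_sqr ler_sqrt ?lerDr ?addr_ge0 ?sqr_ge0.
Qed.

Lemma normc_le (z : R[i]) : Normc.normc z <= `|complex.Re z| + `|complex.Im z|.
Proof.
rewrite normcE -[leRHS]ger0_norm ?addr_ge0// -sqrtr_sqr ler_sqrt ?sqr_ge0//.
rewrite sqrrD !real_normK ?num_real// [leRHS]addrAC lerDl.
by rewrite mulrn_wge0// mulr_ge0.
Qed.

Lemma normc_ge0 (z : R[i]) : 0 <= Normc.normc z.
Proof. by rewrite normcE sqrtr_ge0. Qed.

Lemma normc_continuous (T : topologicalType) (u v : T -> R) (x : T) :
  {for x, continuous u} -> {for x, continuous v} ->
  {for x, continuous (fun y => Normc.normc (Complex (u y) (v y)))}.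
Proof.
move=> cu cv; rewrite /=.
apply: (@continuous_comp _ _ _ (fun y => u y ^+ 2 + v y ^+ 2) Num.sqrt); last exact: sqrt_continuous.
by apply: cvgD; [exact: (cvgM cu cu)|exact: (cvgM cv cv)].
Qed.

End Complex.

Section Smooth.
Context {R : realType} {n : nat}.
Local Notation d := n.+1.
Implicit Types (Omega Q : set 'rV[R]_d) (g : 'rV[R]_d -> R) (f : 'rV[R]_d -> R[i]).

Lemma smooth_line_derivable Omega Q g p : smooth_on Omega g -> Q `<=` Omega ->
  line_derivable p g Q.
Proof.
move=> sg QO i x k _ /QO Ox; have [_ /(_ i) dG] := sg (nseq k i) x Ox.
rewrite /= /partial; set G := partials (nseq k i) g in dG *.
have E : (fun h : R => h^-1 *:
    (((fun t => G (setc x i t)) \o shift (x 0 i)) (h *: 1) - G (setc x i (x 0 i)))) =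
    (fun h : R => h^-1 *: ((G \o shift x) (h *: delta_mx 0 i) - G x)).
  apply/funext => h; rewrite setcK /=; congr (_ *: (G _ - _)).
  apply/rowP => j; rewrite !mxE eqxx /=; case: eqP => [->|_]; first by [].
  by rewrite mulr0 add0r.
apply: DeriveDef; first by rewrite /derivable E; exact: dG.
by rewrite /derive E.
Qed.

Definition axis_index (p : nat) (i : 'I_d) : {ffun 'I_d -> nat} :=
  [ffun j => if j == i then p else 0%N].

Lemma mi_abs_axis p i : mi_abs (axis_index p i) = p.
Proof.
rewrite /mi_abs (bigD1 i)//= ffunE eqxx big1 ?addn0// => j /negbTE ji.
by rewrite ffunE ji.
Qed.

Lemma mpartial_axis p i g : mpartial (axis_index p i) g = partials (nseq p i) g.
Proof.
rewrite /mpartial; congr (partials _ g).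
have : i \in enum 'I_d by rewrite mem_enum.
have := enum_uniq 'I_d; elim: (enum _) => //= j s IH /andP[js us].
have nil : j = i -> flatten [seq nseq (axis_index p i k) k | k <- s] = [::].
  move=> ji; rewrite ji in js; elim: s js {IH us} => //= k s IH.
  by rewrite inE negb_or => /andP[ik /IH ->]; rewrite ffunE eq_sym (negbTE ik).
rewrite inE ffunE; have [ij|ij] := eqVneq j i.
  by rewrite nil// ij cats0.
by move=> /= /IH; exact.
Qed.

End Smooth.

Section Core.
Context {R : realType} {n : nat}.
Local Notation d := n.+1.
Variables (Omega : set 'rV[R]_d).
Hypotheses (Omega_open : open Omega) (Omega_conn : connected Omega) (Omega_bnd : bounded_set Omega).
Variables (kappa r0 : R) (M : nat -> R).
Hypotheses (kappa_gt0 : 0 < kappa) (r0_gt0 : 0 < r0) (M_gt0 : forall k, 0 < M k).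
Implicit Types (x y z : 'rV[R]_d) (f : 'rV[R]_d -> R[i]).

Definition derivative_bounds f := forall (alpha : {ffun 'I_d -> nat}) c, 0 <= c ->
  (forall y, Omega y -> Normc.normc (f y) <= c) ->
  forall y, Omega y -> Normc.normc (cmpartial alpha f y) <= M (mi_abs alpha) * c.


Lemma csmooth_normc_continuous f x : csmooth_on Omega f -> Omega x ->
  {for x, continuous (fun y => Normc.normc (f y))}.
Proof.
move=> [sRe sIm] Ox.
have -> : (fun y => Normc.normc (f y)) =
    (fun y => Normc.normc (Complex (complex.Re (f y)) (complex.Im (f y)))).
  by apply/funext => y; case: (f y).
exact: normc_continuous (sRe [::] x Ox).1 (sIm [::] x Ox).1.
Qed.

(** Smoothness on the open set [Omega] does not prevent a blow-up at its
    boundary, but doubling does: the function is bounded on a small ball. *)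
Lemma doubling_bounded f : csmooth_on Omega f ->
  doubling Omega kappa r0 (fun y => Normc.normc (f y)) ->
  exists2 c, 0 <= c & forall y, Omega y -> Normc.normc (f y) <= c.
Proof.
move=> sf df.
have [->|/set0P[x Ox]] := eqVneq Omega set0; first by exists 0 => // y [].
have [C C0 HC] := controls_Omega Omega_conn Omega_bnd kappa_gt0 r0_gt0.
have /cvgr_lt/(_ (Normc.normc (f x) + 1)) := csmooth_normc_continuous sf Ox.
rewrite ltrDl ltr01 => /(_ isT)/nbhs_ballP[e /= e0 fe].
pose k := Num.bound (r0 / e).
have ke : r0 / 2 ^+ k <= e.
  rewrite ler_pdivrMr ?exprn_gt0// [leRHS]mulrC -ler_pdivrMr//.
  have /archi_boundP/ltW/le_trans : 0 <= r0 / e by rewrite divr_ge0// ltW.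
  by apply; rewrite -natrX ler_nat ltnW// ltn_expl.
have k0 : 0 < r0 / 2 ^+ k by rewrite divr_gt0// exprn_gt0.
have c0 : 0 <= Normc.normc (f x) + 1 by rewrite addr_ge0// normc_ge0.
exists (C * (kappa ^+ k * (Normc.normc (f x) + 1))).
  by rewrite mulr_ge0 ?(ltW C0)// mulr_ge0// exprn_ge0// ltW.
move=> y Oy; apply: (HC _ _ x df) => //.
  by rewrite mulr_ge0// exprn_ge0// ltW.
apply: doubling_iter => // z xz Oz; apply/ltW/fe/ball_rowP; split => // i.
by rewrite distrC (lt_le_trans _ ke)//; exact: eball_coord.
Qed.

(** Applied to the supremum of [f], the best bound [c], the hypothesis gives
    [c <= X * eps + c / 2].  The supremum must be known to be finite. *)
Lemma bound_self_improvement f (eps X : R) : csmooth_on Omega f ->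
  doubling Omega kappa r0 (fun y => Normc.normc (f y)) -> 0 <= eps -> 0 <= X ->
  (forall c, 0 <= c -> (forall y, Omega y -> Normc.normc (f y) <= c) ->
     forall y, Omega y -> Normc.normc (f y) <= X * eps + c / 2) ->
  forall y, Omega y -> Normc.normc (f y) <= 2 * X * eps.
Proof.
move=> sf df e0 X0 self y Oy.
have [c c0 fc] := doubling_bounded sf df.
pose V := [set Normc.normc (f y) | y in Omega].
have supV : has_sup V.
  split; first by exists (Normc.normc (f y)), y.
  by exists c => _ [z Oz <-]; exact: fc.
have fD z : Omega z -> Normc.normc (f z) <= sup V.
  by move=> Oz; apply: sup_upper_bound => //; exists z.
have D0 : 0 <= sup V by apply: le_trans (fD y Oy); exact: normc_ge0.
have : sup V <= X * eps + sup V / 2.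
  by apply: ge_sup; [exact: supV.1|move=> _ [z Oz <-]; exact: self].
have := fD y Oy; rewrite -mulrA; lra.
Qed.

(** The heart of the proof.  Choose the order [p] with [kappa <= 2 ^ p / 2], and
    cut a large cube into cells of side [rho = 2 r0 / 2 ^ l].  For [l] large,
    most of [F] lies so deep inside [Omega] that every cell meeting this part
    is contained in [Omega], and by pigeonhole [F] fills a proportion at least
    [theta] of one such cell, with [theta] independent of [l].
    [cube_remez] bounds [f] on this cell by a multiple of [eps + rho ^ p * c],
    where [c] is any bound for [f] on [Omega].  The cell contains a ball of
    radius [r0 / 2 ^ l]; the passage from there to [Omega] costs a factor
    [kappa ^ l], up to a constant.  As [kappa ^ l * rho ^ p] decays like
    [2 ^- l], for large [l] the error term is at most [c / 2]. *)
Lemma sup_le_on_positive_measure (v : R) : 0 < v -> exists2 C, 0 < C &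
  forall F f eps, F `<=` Omega -> (v%:E <= lebesgue_outer F)%E ->
  csmooth_on Omega f -> derivative_bounds f ->
  doubling Omega kappa r0 (fun y => Normc.normc (f y)) ->
  0 <= eps -> (forall x, F x -> Normc.normc (f x) <= eps) ->
  forall y, Omega y -> Normc.normc (f y) <= C * eps.
Proof.
move=> v0.
have [C0 C00 HC0] := controls_Omega Omega_conn Omega_bnd kappa_gt0 r0_gt0.
have [B B0 OB] := bounded_coord Omega_bnd.
have pow_bound (t : R) : 0 <= t -> exists k, t <= 2 ^+ k.
  move=> /archi_boundP/ltW tb; exists (Num.bound t); rewrite (le_trans tb)//.
  by rewrite -natrX ler_nat ltnW// ltn_expl.
have [j Bj] : exists j, B / r0 <= 2 ^+ j by apply: pow_bound; rewrite divr_ge0// ltW.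
have [p kp] : exists p, 2 * kappa <= 2 ^+ p by apply: pow_bound; rewrite mulr_ge0// ltW.
pose L := 2 * (r0 * 2 ^+ j).
have r0j : 0 < r0 * 2 ^+ j by rewrite mulr_gt0// exprn_gt0.
have L0 : 0 < L by rewrite mulr_gt0.
pose a : 'rV[R]_d := corner (r0 * 2 ^+ j).
have OL : Omega `<=` cube a L.
  apply: sub_cube_corner => x Ox i; rewrite (lt_le_trans (OB x Ox i))//.
  by rewrite mulrC -ler_pdivrMr.
pose theta := v / (2 * L ^+ d).
have theta0 : 0 < theta by rewrite divr_gt0// mulr_gt0// exprn_gt0.
have [C1 C10 remez] := cube_remez (n := n) p theta0.
pose W := C0 * (2 * C1) * M p * (2 * r0) ^+ p.
have W0 : 0 < W by rewrite !mulr_gt0// exprn_gt0// mulr_gt0.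
have [N exhaust] := inner_exhaustion Omega_open Omega_bnd
  (mulr_gt0 (ltr0n _ 2) r0_gt0 : 0 < 2 * r0) (divr_gt0 v0 (ltr0n _ 4) : 0 < v / 4).
have [l1 Wl1] : exists l, 2 * W <= 2 ^+ l by apply: pow_bound; rewrite mulr_ge0// ltW.
pose l := maxn N l1.
have {}Wl1 : W / 2 ^+ l <= 2^-1.
  rewrite ler_pdivrMr ?exprn_gt0// ler_pdivlMl// (le_trans Wl1)//.
  by rewrite ler_weXn2l ?ler1n// leq_maxr.
pose rho := 2 * r0 / 2 ^+ l.
have rho0 : 0 < rho by rewrite divr_gt0 ?mulr_gt0// exprn_gt0.
pose X := C0 * kappa ^+ l * (2 * C1).
have X0 : 0 < X by rewrite !mulr_gt0// exprn_gt0.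
(* kappa / 2 ^ p <= 1 / 2, so the error term gains a factor 2 with each l *)
have absorb : X * (M p * rho ^+ p) <= 2^-1.
  apply: le_trans Wl1.
  have -> : X * (M p * rho ^+ p) = W * (kappa / 2 ^+ p) ^+ l.
    rewrite /X /W /rho !expr_div_n -!exprM (mulnC p l) exprM exprMn.
    by ring.
  rewrite ler_pM2l// -[leRHS]exprVn lerXn2r ?nnegrE//; first by rewrite divr_ge0 ?exprn_ge0// ltW.
  by rewrite ler_pdivrMr ?exprn_gt0// ler_pdivlMl.
exists (2 * X); first by rewrite mulr_gt0.
move=> F f eps FO vF sf bf df e0 Fe.
apply: (bound_self_improvement sf df e0 (ltW X0)) => c c0 fc.
pose G := [set x | ball x rho `<=` Omega].
pose K := (2 ^ (j + l))%N.
have rhoK : rho * K%:R = L.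
  rewrite /rho /K /L natrX exprD; field; rewrite expf_neq0//.
(* otherwise F `&` G would have measure at most v / 2; it has at least 3 v / 4 *)
have [s muS] : exists s, ((theta * rho ^+ d)%:E < lebesgue_outer ((F `&` G) `&` slab a rho K 0 s))%E.
  apply: contrapT => /forallNP small.
  have {}small s : (lebesgue_outer ((F `&` G) `&` slab a rho K 0 s) <= (theta * rho ^+ d)%:E)%E.
    by rewrite leNgt; apply/negP.
  have := lebesgue_outer_slab small (fun=> 0%N) (leqnn d).
  rewrite slab_cube rhoK setIidl; last by move=> x [/FO/OL].
  apply/negP; rewrite -ltNge.
  apply: (@le_lt_trans _ _ (v / 2)%:E).
    rewrite lee_fin (le_trans (grid_sum_bound (B := theta * rho ^+ d) _ _ _ _))//.
    rewrite -mulrA -exprMn rhoK /theta le_eqVlt; apply/orP; left; apply/eqP; field.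
    by rewrite gt_eqF// exprn_gt0.
  have FG : (lebesgue_outer F <= lebesgue_outer (F `&` G) + (v / 4)%:E)%E.
    apply: (le_trans (le_outer_measureIC (lebesgue_outer_measure R n) G F)).
    rewrite leeD2l// (le_trans _ (exhaust l (leq_maxl _ _)))//.
    by apply: le_lebesgue_outer => x [Fx xG]; split; [exact: FO|].
  rewrite ltNge; apply/negP => FGv; have := le_trans vF (le_trans FG (leeD2r _ FGv)).
  by rewrite -EFinD lee_fin; lra.
pose a' : 'rV[R]_d := \row_i (a 0 i + rho * (s i)%:R).
have slabE : slab a rho K 0 s = cube a' rho.
  apply/seteqP; split => x xs i; have := xs i; rewrite /= !mxE -(natr1 (s i)) mulrDr mulr1 addrA//.
rewrite slabE in muS.
have [x1 [[Fx1 Gx1] Qx1]] : exists x, ((F `&` G) `&` cube a' rho) x.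
  apply/set0P/eqP => F0; move: muS; rewrite F0 lebesgue_outer0 lte_fin ltNge.
  by rewrite mulr_ge0 ?exprn_ge0// ltW.
have QO : cube a' rho `<=` Omega.
  move=> y Qy; apply: Gx1; apply/ball_rowP; split => // i.
  have /andP[? ?] := Qx1 i; have /andP[? ?] := Qy i.
  by rewrite ltr_norml; apply/andP; split; lra.
have cubeB : bounded_on Omega (fun y => Normc.normc (f y)) (cube a' rho)
    (2 * C1 * (eps + M p * c * rho ^+ p)).
  move=> y Qy Oy.
  have part (g : 'rV[R]_d -> R) : smooth_on Omega g ->
      (forall z, `|g z| <= Normc.normc (f z)) ->
      (forall alpha z, `|mpartial alpha g z| <= Normc.normc (cmpartial alpha f z)) ->
      `|g y| <= C1 * (eps + M p * c * rho ^+ p).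
    move=> sg gf dgf.
    have bound q i z : cube a' rho z -> `|partials (nseq q i) g z| <= M q * c.
      move=> /QO Oz; rewrite -mpartial_axis (le_trans (dgf _ z))//.
      by rewrite -{2}(mi_abs_axis q i); exact: bf.
    apply: (remez g a' rho eps _ (M 1%N * c) ((F `&` G) `&` cube a' rho)) => //.
    - by rewrite mulr_ge0// ltW.
    - by rewrite mulr_ge0// ltW.
    - exact: smooth_line_derivable sg QO.
    - exact: smooth_line_derivable sg QO.
    - by move=> i z /(bound p i).
    - by move=> i z /(bound 1%N i).
    - by move=> z [[Fz _] _]; rewrite (le_trans (gf z))// Fe.
    - by rewrite -setIA setIid ltW.
  rewrite (le_trans (normc_le _))// -mulrA mulr_natl mulr2n lerD//.
    by apply: (part (fun z => complex.Re (f z)) sf.1) =>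
      [z|alpha z]; [exact: normc_Re|exact: (normc_Re (cmpartial alpha f z))].
  by apply: (part (fun z => complex.Im (f z)) sf.2) =>
      [z|alpha z]; [exact: normc_Im|exact: (normc_Im (cmpartial alpha f z))].
(* the centre of the cell *)
pose z0 : 'rV[R]_d := \row_i (a' 0 i + rho / 2).
have r0l : r0 / 2 ^+ l = rho / 2 by rewrite /rho; field; rewrite expf_neq0.
have r0l0 : 0 < r0 / 2 ^+ l by rewrite r0l divr_gt0.
have z0Q : cube a' rho z0 by move=> i; rewrite [z0 0 i]mxE; apply/andP; split; lra.
have ballQ : eball z0 (r0 / 2 ^+ l) `<=` cube a' rho.
  move=> y z0y i; have := eball_coord i r0l0 z0y; rewrite [z0 0 i]mxE r0l.
  by rewrite ltr_norml => /andP[? ?]; apply/andP; split; lra.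
have T0 : 0 <= 2 * C1 * (eps + M p * c * rho ^+ p).
  by rewrite mulr_ge0 ?mulr_ge0 ?(ltW C10)// addr_ge0// mulr_ge0 ?exprn_ge0 ?(ltW rho0)// mulr_ge0// ltW.
move=> y Oy.
have := HC0 _ _ z0 df _ (QO _ z0Q) (doubling_iter kappa_gt0 r0_gt0 df (QO _ z0Q) T0
  (fun y yz => cubeB y (ballQ y yz))) y I Oy.
rewrite mulr_ge0 ?exprn_ge0 ?(ltW kappa_gt0)// => /(_ isT) /le_trans; apply.
have -> : C0 * (kappa ^+ l * (2 * C1 * (eps + M p * c * rho ^+ p))) =
  X * eps + c * (X * (M p * rho ^+ p)) by rewrite /X; ring.
by rewrite lerD2l ler_wpM2l.
Qed.

End Core.

(** * Essential suprema *)

Section Linfty.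
Context {R : realType} {n : nat}.
Implicit Types (A N : set 'rV[R]_n.+1) (f : 'rV[R]_n.+1 -> R[i]) (c : R).

Lemma Linfty_le A f c : 0 <= c -> (forall x, A x -> Normc.normc (f x) <= c) ->
  (Linfty A f <= c%:E)%E.
Proof.
move=> c0 fc; rewrite /Linfty unlock; case: ifP => _; last by rewrite lee_fin.
apply/ess_supP; apply: nearW => x /=; rewrite patchE; case: ifPn => [/set_mem Ax|_].
  by rewrite /= lee_fin ger0_norm ?fc// normc_ge0.
by rewrite abse0 lee_fin.
Qed.

Lemma Linfty_ae A f c : (0 < @lebesgue_outer R n.+1 setT)%E -> (Linfty A f <= c%:E)%E ->
  exists2 N, lebesgue_outer N = 0%E & forall x, A x -> ~ N x -> Normc.normc (f x) <= c.
Proof.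
rewrite /Linfty unlock => T0; rewrite [(_ < _)%E]T0 => /ess_supP[N [_ N0 fN]].
exists N => // x Ax Nx; apply: contrapT => fc; apply: Nx; apply: fN => /=.
rewrite patchE mem_set//= lee_fin ger0_norm//.
exact: normc_ge0.
Qed.

(** For a function that is continuous at an interior point of [A], the essential
    supremum bounds the actual value there, because nonempty open sets are not
    null; this is where some bounded set of positive measure is needed. *)
Lemma Linfty_nbhs A f c (x : 'rV[R]_n.+1) (E : set 'rV[R]_n.+1) :
  bounded_set E -> (0 < lebesgue_outer E)%E ->
  nbhs x A -> {for x, continuous (fun y => Normc.normc (f y))} ->
  (Linfty A f <= c%:E)%E -> Normc.normc (f x) <= c.
Proof.
move=> bE E0 xA cf Ac; rewrite leNgt; apply/negP => cfx.
have T0 : (0 < @lebesgue_outer R n.+1 setT)%E.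
  by rewrite (lt_le_trans E0)//; exact: le_lebesgue_outer.
have [N N0 fN] := Linfty_ae T0 Ac.
have : nbhs x N.
  have cx : nbhs x [set y | c < Normc.normc (f y)] by exact: cvgr_gt cf _ cfx.
  have sub : A `&` [set y | c < Normc.normc (f y)] `<=` N.
    move=> y [/= Ay cy].
    by apply: contrapT => /(fN y Ay); rewrite leNgt cy.
  exact: filterS sub (filterI xA cx).
by move=> /(lebesgue_outer_nbhs bE E0); rewrite N0 ltxx.
Qed.

End Linfty.

Unset Implicit Arguments.
Set Strict Implicit.
Set Printing Implicit Defensive.

Theorem theorem2p1 (R : realType) (n : nat) (Omega : set 'rV[R]_n.+1)
    (Omega_C1 : C1_domain Omega) (Omega_conn : connected Omega)
    (Omega_bnd : bounded_set Omega)
    (M delta kappa r0 sigma : R)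
    (M_gt0 : 0 < M) (delta_gt0 : 0 < delta) (kappa_gt0 : 0 < kappa)
    (r0_gt0 : 0 < r0) (sigma_ge1 : 1 <= sigma) :
  exists C : R -> R, (forall t : R, 0 < C t) /\
    forall E : set (lebesgue_space R n),
      measurable E -> E `<=` Omega -> (0 < lebesgue R n E)%E ->
    forall f : 'rV[R]_n.+1 -> R[i],
      csmooth_on Omega f ->
      (forall alpha : {ffun 'I_n.+1 -> nat},
        (Linfty Omega (cmpartial alpha f) <=
         (M * ((mi_abs alpha)`!%:R `^ sigma) / delta ^+ mi_abs alpha)%:E
           * Linfty Omega f)%E) ->
      (forall (r : R) (x : 'rV[R]_n.+1), 0 < r -> r <= r0 -> Omega x ->
        (Linfty (eball x (2 * r) `&` Omega) f <=
         kappa%:E * Linfty (eball x r `&` Omega) f)%E) ->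
      (Linfty Omega f <=
       (C (fine (lebesgue R n Omega) / fine (lebesgue R n E)))%:E
         * Linfty E f)%E.
Proof.
have Omega_open : open Omega by case: Omega_C1.
pose D k := M * (k`!%:R `^ sigma) / delta ^+ k.
have D_gt0 k : 0 < D k.
  by rewrite divr_gt0 ?exprn_gt0// mulr_gt0// powR_gt0// ltr0n fact_gt0.
have fin_sub (A : set 'rV[R]_n.+1) : A `<=` Omega -> lebesgue_outer A \is a fin_num.
  move=> AO; rewrite ge0_fin_numE ?lebesgue_outer_ge0//.
  by rewrite (le_lt_trans (le_lebesgue_outer AO))// lebesgue_outer_bounded.
(* C t serves all sets whose measure is |Omega| / t *)
pose good (t C : R) := 0 < C /\ (0 < fine (lebesgue_outer Omega) / t ->
  forall F f (eps : R), F `<=` Omega ->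
  ((fine (lebesgue_outer Omega) / t)%:E <= lebesgue_outer F)%E ->
  csmooth_on Omega f -> derivative_bounds Omega D f ->
  doubling Omega kappa r0 (fun y => Normc.normc (f y)) ->
  0 <= eps -> (forall x, F x -> Normc.normc (f x) <= eps) ->
  forall y, Omega y -> Normc.normc (f y) <= C * eps).
have /choice[C goodC] : forall t, exists C, good t C.
  move=> t; have [t0|t0] := ltP 0 (fine (lebesgue_outer Omega) / t); last first.
    by exists 1; split => //; rewrite ltNge t0.
  have [C C0 HC] := sup_le_on_positive_measure Omega_open Omega_conn Omega_bnd kappa_gt0 r0_gt0 D_gt0 t0.
  by exists C.
exists C; split => [t|E _ EO E0 f sf bf df]; first by have [] := goodC t.
have E_fin := fin_sub E EO.
have E_gt0 : 0 < fine (lebesgue_outer E) 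
  by apply: fine_gt0; apply/andP; split; [exact: E0|rewrite -ge0_fin_numE ?lebesgue_outer_ge0].
have O_gt0 : 0 < fine (lebesgue_outer Omega).
  by apply: lt_le_trans E_gt0 _; rewrite fine_le ?fin_sub//; exact: le_lebesgue_outer.
set t := fine _ / fine _.
have tE : fine (lebesgue_outer Omega) / t = fine (lebesgue_outer E).
  by rewrite /t invf_div mulrC divfK// gt_eqF.
have [C0 HC] := goodC t; rewrite tE in HC.
have T0 : (0 < @lebesgue_outer R n.+1 setT)%E.
  by rewrite (lt_le_trans E0)//; exact: le_lebesgue_outer.
have O0 : (0 < lebesgue_outer Omega)%E.
  by rewrite (lt_le_trans E0)//; exact: le_lebesgue_outer.
have nbhs_le (A : set 'rV[R]_n.+1) (x : 'rV[R]_n.+1) c : open A -> A x -> Omega x ->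
    (Linfty (A `&` Omega) f <= c%:E)%E -> Normc.normc (f x) <= c.
  move=> oA Ax Ox; apply: (Linfty_nbhs Omega_bnd O0); last exact: csmooth_normc_continuous sf Ox.
  by apply: open_nbhs_nbhs; split; [exact: openI|].
have [->|Efin] := eqVneq (Linfty E f) +oo%E; first by rewrite gt0_muley ?leey.
have Ege0 : (0 <= Linfty E f)%E by exact: Lnorm_ge0.
have [eps epsE] : exists eps, Linfty E f = eps%:E.
  by exists (fine (Linfty E f)); rewrite fineK// ge0_fin_numE// ltey.
rewrite epsE -EFinM; rewrite epsE lee_fin in Ege0.
apply: Linfty_le; first by rewrite mulr_ge0// ltW.
have Ele : (Linfty E f <= eps%:E)%E by rewrite epsE.
have [N N0 fN] := Linfty_ae T0 Ele.
(* F is E without the null set on which |f| exceeds its L^oo norm over E *)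
have EN : (lebesgue_outer E <= lebesgue_outer (E `\` N))%E.
  have := le_outer_measureIC (lebesgue_outer_measure R n) N E.
  have -> : lebesgue_outer_measure R n (E `&` N) = 0%E.
    by apply/eqP; rewrite eq_le lebesgue_outer_ge0 andbT -N0 le_lebesgue_outer//; exact: subIsetr.
  by rewrite add0e.
apply: (HC E_gt0 (E `\` N)) => //.
- by move=> x [/EO].
- by rewrite fineK.
- move=> alpha c c0 fc y Oy.
  apply: (Linfty_nbhs Omega_bnd O0).
  + by apply: open_nbhs_nbhs; split; [exact: Omega_open|].
  + exact: normc_continuous (sf.1 _ y Oy).1 (sf.2 _ y Oy).1.
  + apply: (le_trans (bf alpha)); rewrite [leRHS]EFinM.
    by apply: lee_wpmul2l; [rewrite lee_fin; exact: ltW (D_gt0 _)|exact: Linfty_le].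
- move=> r x c r_gt0 rr0 Ox c0 fc y xy Oy.
  apply: (nbhs_le (eball x (2 * r))) => //; first exact: eball_open.
  apply: (le_trans (df r x r_gt0 rr0 Ox)); rewrite EFinM.
  apply: lee_wpmul2l; first by rewrite lee_fin ltW.
  by apply: Linfty_le => // z []; exact: fc.
- by move=> x [Ex Nx]; exact: fN.
Qed.
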